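(* Let $k$ be a field and let $\Sigma=F\bowtie G$ be the group associated to a matched pair $(G,F,\rhd,\lhd)$ of finite groups. Then $$\operatorname{Opext}_{\rhd,\lhd}(kF,k^G)\cong H^3_{\mathscr{A}}(\Sigma,X;k^\times),$$ where $k^\times$ is considered as a trivial $\Sigma$-module.
   Context: A matched pair of groups $(G,F,\rhd,\lhd)$ consists of groups $G,F$, a left action $\rhd:G\times F\to F$ of $G$ on the set $F$ and a right action $\lhd:G\times F\to G$ of $F$ on the set $G$, such that $s\rhd(xy)=(s\rhd x)((s\lhd x)\rhd y)$ and $(st)\lhd x=(s\lhd(t\rhd x))(t\lhd x)$ for all $s,t\in G$, $x,y\in F$. The group $F\bowtie G$ is the set $F\times G$ with product $(x,s)(y,t)=(x(s\rhd y),(s\lhd y)t)$. Relative cohomology (Auslander): the set $F$ is a left $\Sigma$-set by $(f,g)\cdot x=f(g\rhd x)$, and $G$ is a right $\Sigma$-set by $s\cdot(f,g)=(s\lhd f)g$, made into a left $\Sigma$-set using inverses. $X$ is the left $\Sigma$-set $F\sqcup G$, $\Lambda_X$ is the kernel of the augmentation $\mathbb{Z}[X]\to\mathbb{Z}$, $x\mapsto1$, and for a $\Sigma$-module $A$ and $n\ge1$, $H^n_{\mathscr{A}}(\Sigma,X;A):=\operatorname{Ext}^{n-1}_{\mathbb{Z}\Sigma}(\Lambda_X,A)$. $\operatorname{Opext}$: consider pairs $(\sigma,\tau)$ of maps $\sigma:G\times F\times F\to k^\times$, $\tau:G\times G\times F\to k^\times$ that are normalized ($\sigma(s;x,y)=1$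 if $x=e$ or $y=e$; $\tau(s,t;x)=1$ if $s=e$ or $t=e$), are 2-cocycles, $$\sigma(s\lhd x;y,z)\sigma(s;x,yz)=\sigma(s;x,y)\sigma(s;xy,z),\qquad \tau(st,r;x)\tau(s,t;r\rhd x)=\tau(s,tr;x)\tau(t,r;x),$$ and are compatible, $$\sigma(st;x,y)\tau(s,t;xy)=\sigma(s;t\rhd x,(t\lhd x)\rhd y)\,\sigma(t;x,y)\,\tau(s,t;x)\,\tau(s\lhd(t\rhd x),t\lhd x;y),$$ for all $s,t,r\in G$, $x,y,z\in F$. Such a pair defines a Hopf algebra $k^G\#_{\sigma,\tau}kF$ with basis $\{e_s\#x: s\in G,x\in F\}$, product $(e_s\#x)(e_t\#y)=\delta_{s\lhd x,t}\,\sigma(s;x,y)\,e_s\#xy$ and coproduct $\Delta(e_s\#x)=\sum_{ab=s}\tau(a,b;x)\,e_a\#(b\rhd x)\otimes e_b\#x$, and a Hopf algebra extension $k\to k^G\xrightarrow{i}k^G\#_{\sigma,\tau}kF\xrightarrow{\pi}kF\to k$ with $i(e_s)=e_s\#e$, $\pi(e_s\#x)=\delta_{s,e}x$. Two extensions $A,A'$ of $kF$ by $k^G$ are equivalent if there is a Hopf algebra homomorphism $f:A\to A'$ with $f i=i'$ and $\pi' f=\pi$. $\operatorname{Opext}_{\rhd,\lhd}(kF,k^G)$ is the set of equivalence classes of these extensions for the fixed matched pair, an abelian group under the Baer product, which is induced by pointwise multiplication of pairs $(\sigma,\tau)$. *)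

(* Defs.v *)
From HB Require Import structures.
From mathcomp Require Import all_boot all_order all_fingroup all_algebra.
From mathcomp Require Import boolp.
From mathcomp Require Import finmap monalg.

Set Implicit Arguments.
Unset Strict Implicit.
Unset Printing Implicit Defensive.

Import GRing.Theory.
Local Open Scope ring_scope.

(** * Ext over an arbitrary ring *)

Section Hom.
Variables (R : nzRingType) (U V : lmodType R).
Implicit Types f g h : {linear U -> V}.

HB.instance Definition _ := gen_eqMixin {linear U -> V}.
HB.instance Definition _ := gen_choiceMixin {linear U -> V}.

Lemma linear_ext f g : f =1 g -> f = g.
Proof.
move=> /funext; case: f g => f cf [g cg] /= fg.
case: _ / fg cg => -[[a1] [a2]]; case: cf => [[b1] [b2]].
by rewrite (Prop_irrelevance a1 b1) (Prop_irrelevance a2 b2).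
Qed.

Definition lin0 : {linear U -> V} := \0.
Definition linN f : {linear U -> V} := \- f.
Definition linD f g : {linear U -> V} := f \+ g.

Lemma linDA : associative linD.
Proof. by move=> f g h; apply: linear_ext => x /=; rewrite addrA. Qed.
Lemma linDC : commutative linD.
Proof. by move=> f g; apply: linear_ext => x /=; rewrite addrC. Qed.
Lemma lin0D : left_id lin0 linD.
Proof. by move=> f; apply: linear_ext => x /=; rewrite add0r. Qed.
Lemma linND : left_inverse lin0 linN linD.
Proof. by move=> f; apply: linear_ext => x /=; rewrite addNr. Qed.

HB.instance Definition _ :=
  GRing.isZmodule.Build {linear U -> V} linDA linDC lin0D linND.
End Hom.

Section Kernel.
Variables (R : nzRingType) (U V : lmodType R) (f : {linear U -> V}).

Definition ker_pred : {pred U} := fun x => f x == 0.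

Lemma ker_submod_closed : submod_closed ker_pred.
Proof.
split=> [|a x y]; rewrite !unfold_in /ker_pred; first by rewrite linear0.
by move=> /eqP fx /eqP fy; rewrite linearP fx fy scaler0 addr0.
Qed.
HB.instance Definition _ :=
  GRing.isSubmodClosed.Build R U ker_pred ker_submod_closed.

Record ker : predArgType := Ker { ker_val : U; _ : ker_val \in ker_pred }.
HB.instance Definition _ := [isSub for ker_val].
HB.instance Definition _ := [Choice of ker by <:].
HB.instance Definition _ := [SubChoice_isSubLmodule of ker by <:].
Definition ker_incl : {linear ker -> U} := \val.
End Kernel.

Section Free.
Variables (R : nzRingType) (K : choiceType) (M : lmodType R) (h : K -> M).
Definition malg_lift (g : {malg R[K]}) : M := \sum_(x <- msupp g) g@_x *: h x.

Lemma malg_liftEw (d : {fset K}) g : (msupp g `<=` d)%fset ->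
  malg_lift g = \sum_(x <- d) g@_x *: h x.
Proof.
move=> le; rewrite /malg_lift; apply: (big_fset_incl _ le) => x _ /mcoeff_outdom ->.
by rewrite scale0r.
Qed.

Lemma malg_lift_linear : linear malg_lift.
Proof.
move=> a g1 g2; pose d := (msupp (a *: g1 + g2) `|` (msupp g1 `|` msupp g2))%fset.
rewrite !(@malg_liftEw d) ?fsubsetUl //.
- rewrite scaler_sumr -big_split; apply: eq_bigr => x _ /=.
  by rewrite mcoeffD mcoeffZ scalerDl scalerA.
- by rewrite (fsubset_trans (fsubsetUr _ _) (fsubsetUr _ _)).
- by rewrite (fsubset_trans (fsubsetUl _ _) (fsubsetUr _ _)).
Qed.
HB.instance Definition _ :=
  GRing.isLinear.Build R {malg R[K]} M *:%R malg_lift malg_lift_linear.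

Lemma malg_liftU x : malg_lift << x >> = h x.
Proof. by rewrite (malg_liftEw msuppU_le) big_seq_fset1 mcoeffUU scale1r. Qed.
End Free.

Definition projective (R : nzRingType) (P : lmodType R) : Prop :=
  forall (U V : lmodType R) (g : {linear U -> V}) (f : {linear P -> V}),
    (forall v, exists u, g u = v) ->
    exists h : {linear P -> U}, forall x, g (h x) = f x.

Lemma malg_linear_ext (R : nzRingType) (K : choiceType) (M : lmodType R)
    (f g : {linear {malg R[K]} -> M}) :
  (forall x : K, f << x >> = g << x >>) -> f =1 g.
Proof.
move=> fg u; rewrite (monalgE u) !linear_sum; apply: eq_bigr => x _.
have -> : << u@_x *g x >> = u@_x *: << x >> :> {malg R[K]}.
  by apply/malgP => y; rewrite mcoeffZ !mcoeffU mulr_natr.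
by rewrite !linearZ fg.
Qed.

Lemma malg_projective (R : nzRingType) (K : choiceType) :
  projective ({malg R[K]} : lmodType R).
Proof.
move=> U V g f gsurj.
have [s sP] := boolp.choice (fun x : K => gsurj (f << x >>)).
exists (malg_lift s : {linear _ -> _}) => x.
apply: (malg_linear_ext (f := g \o malg_lift s)) => y /=.
by rewrite malg_liftU.
Qed.

Record projres (R : nzRingType) (M : lmodType R) := ProjRes {
  pr_obj :> nat -> lmodType R;
  pr_d : forall n, {linear pr_obj n.+1 -> pr_obj n};
  pr_aug : {linear pr_obj 0 -> M};
  pr_projective : forall n, projective (pr_obj n);
  pr_aug_surj : forall m, exists x, pr_aug x = m;
  pr_exact0 : forall x, pr_aug x = 0 <-> exists y, x = pr_d 0 y;
  pr_exactS : forall n x, pr_d n x = 0 <-> exists y, x = pr_d n.+1 y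
}.

Section Cohomology.
Variables (R : nzRingType) (M : lmodType R) (P : projres M) (A : lmodType R).

Definition is_coboundary (n : nat) : {linear P n -> A} -> Prop :=
  match n return {linear P n -> A} -> Prop with
  | 0 => fun f => f = 0
  | m.+1 => fun f => exists g : {linear P m -> A}, forall x, f x = g (pr_d P m x)
  end.

Lemma is_coboundary0 n : is_coboundary (0 : {linear P n -> A}).
Proof. by case: n => //= m; exists 0. Qed.

Lemma is_coboundaryB n (f g : {linear P n -> A}) :
  is_coboundary f -> is_coboundary g -> is_coboundary (f - g).
Proof.
case: n f g => [f g -> ->|m f g [f' Ef] [g' Eg]] /=; first by rewrite subrr.
by exists (f' - g') => x /=; rewrite Ef Eg.
Qed.

Variable n : nat.

Definition cocycle_pred : {pred {linear P n -> A}} :=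
  fun f => `[< forall x, f (pr_d P n x) = 0 >].

Lemma cocycle_zmod_closed : zmod_closed cocycle_pred.
Proof.
split=> [|f g]; rewrite !unfold_in /cocycle_pred; first by apply/asboolP.
move=> /asboolP df /asboolP dg; apply/asboolP => x /=.
by rewrite df dg subrr.
Qed.
HB.instance Definition _ :=
  GRing.isZmodClosed.Build {linear P n -> A} cocycle_pred cocycle_zmod_closed.

Record cocycle : predArgType :=
  Cocycle { cocycle_val : {linear P n -> A}; _ : cocycle_val \in cocycle_pred }.
HB.instance Definition _ := [isSub for cocycle_val].
HB.instance Definition _ := [Choice of cocycle by <:].
HB.instance Definition _ := [SubChoice_isSubZmodule of cocycle by <:].

Definition coboundary_pred : {pred cocycle} := fun z => `[< is_coboundary (val z) >].

Lemma coboundary_zmod_closed : zmod_closed coboundary_pred.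
Proof.
split=> [|y z]; rewrite !unfold_in /coboundary_pred.
  by apply/asboolP; rewrite raddf0; apply: is_coboundary0.
move=> /asboolP hy /asboolP hz; apply/asboolP; rewrite raddfB.
exact: is_coboundaryB.
Qed.
HB.instance Definition _ :=
  GRing.isZmodClosed.Build cocycle coboundary_pred coboundary_zmod_closed.

Definition cohomology : zmodType := Quotient.quot coboundary_pred.
End Cohomology.

(* The standard free resolution: cover a module by the free module on its
   underlying set, and iterate on the kernel. *)
Section StdRes.
Variables (R : nzRingType) (M : lmodType R).

Definition free_cover (N : lmodType R) : {linear {malg R[N]} -> N} :=
  malg_lift (id : N -> N).

Fixpoint syzygy (n : nat) : lmodType R :=
  if n is m.+1 then ker (free_cover (syzygy m)) else M.

Definition std_obj (n : nat) : lmodType R := {malg R[syzygy n]}.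
Definition std_d (n : nat) : {linear std_obj n.+1 -> std_obj n} :=
  ker_incl (free_cover (syzygy n)) \o free_cover (syzygy n.+1).

Lemma free_cover_surj (N : lmodType R) (x : N) : exists u, free_cover N u = x.
Proof. by exists << x >>; rewrite /free_cover /= malg_liftU. Qed.

Lemma std_exact (n : nat) x :
  free_cover (syzygy n) x = 0 <-> exists y, x = std_d n y.
Proof.
split=> [x0|[y ->]].
  have xk : x \in ker_pred (free_cover (syzygy n)) by apply/eqP.
  have [y yE] := free_cover_surj (Ker xk : syzygy n.+1).
  by exists y; rewrite /std_d /= yE.
by rewrite /std_d /=; case: (malg_lift _ y) => z /= /eqP.
Qed.

Lemma std_exactS (n : nat) x : std_d n x = 0 <-> exists y, x = std_d n.+1 y.
Proof.
rewrite -std_exact /std_d; split=> [xd|x0].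
  by apply: val_inj; rewrite raddf0.
by change (val (free_cover (syzygy n.+1) x) = 0); rewrite x0 raddf0.
Qed.

Definition std_res : projres M := @ProjRes R M std_obj std_d (free_cover M)
  (fun n => @malg_projective R (syzygy n)) (@free_cover_surj M)
  (@std_exact 0) (@std_exactS).
End StdRes.

Definition Ext (R : nzRingType) (n : nat) (M A : lmodType R) : zmodType :=
  cohomology (std_res M) A n.

(** * Modules over the integral group ring of a finite group *)

Section GroupRing.
Variable S : finGroupType.

Definition group_ring : Type := {ffun S -> int}.
HB.instance Definition _ := GRing.Zmodule.on group_ring.
Implicit Types a b c : group_ring.

Definition gr_elt (g : S) : group_ring := [ffun h => (h == g)%:R].
Definition gr_mul a b : group_ring :=
  [ffun g => \sum_h a h * b (h^-1 * g)%g].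

Lemma gr_mulA : associative gr_mul.
Proof.
move=> a b c; apply/ffunP => g; rewrite !ffunE.
under eq_bigr do rewrite ffunE mulr_sumr.
under [RHS]eq_bigr do rewrite ffunE mulr_suml.
rewrite [RHS]exchange_big; apply: eq_bigr => h _ /=.
rewrite [RHS](reindex_inj (mulgI h)); apply: eq_bigr => i _ /=.
by rewrite mulrA mulKg invMg mulgA.
Qed.
Lemma gr_mul1 : left_id (gr_elt 1%g) gr_mul.
Proof.
move=> a; apply/ffunP => g; rewrite ffunE (bigD1 1%g) //= ffunE eqxx mul1r.
rewrite invg1 mul1g big1 ?addr0 // => h /negPf h1.
by rewrite ffunE h1 mul0r.
Qed.
Lemma gr_mulr1 : right_id (gr_elt 1%g) gr_mul.
Proof.
move=> a; apply/ffunP => g; rewrite ffunE (bigD1 g) //= ffunE mulVg eqxx mulr1.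
rewrite big1 ?addr0 // => h hg; rewrite ffunE -eq_mulVg1.
by rewrite (negPf hg) mulr0.
Qed.
Lemma gr_mulDl : left_distributive gr_mul +%R.
Proof.
move=> a b c; apply/ffunP => g; rewrite !ffunE -big_split.
by apply: eq_bigr => h _; rewrite ffunE mulrDl.
Qed.
Lemma gr_mulDr : right_distributive gr_mul +%R.
Proof.
move=> a b c; apply/ffunP => g; rewrite !ffunE -big_split.
by apply: eq_bigr => h _; rewrite ffunE mulrDr.
Qed.
Lemma gr_one_neq0 : gr_elt 1%g != 0.
Proof. by apply/eqP => /ffunP/(_ 1%g); rewrite !ffunE eqxx. Qed.

HB.instance Definition _ := GRing.Zmodule_isNzRing.Build group_ring
  gr_mulA gr_mul1 gr_mulr1 gr_mulDl gr_mulDr gr_one_neq0.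

Lemma gr_eltM g h : gr_elt (g * h)%g = gr_elt g * gr_elt h.
Proof.
apply/ffunP => i; rewrite !ffunE (bigD1 g) //= !ffunE eqxx mul1r.
rewrite big1 ?addr0 => [|j /negPf jg]; last by rewrite ffunE jg mul0r.
by rewrite -[in RHS](inj_eq (mulgI g)) mulVKg.
Qed.
End GroupRing.

(* An abelian group with an additive left action of S, the same thing as a left
   module over the group ring; [gmod] is the passage to [lmodType]. *)
Record gmodule (S : finGroupType) := GModule {
  gm_car : zmodType;
  gm_act : S -> gm_car -> gm_car;
  gm_act1 : forall u, gm_act 1%g u = u;
  gm_actM : forall g h u, gm_act (g * h)%g u = gm_act g (gm_act h u);
  gm_actD : forall g, {morph gm_act g : u v / u + v}
}.

Section GModuleLmod.
Variables (S : finGroupType) (M : gmodule S).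

Definition gmod : Type := gm_car M.
HB.instance Definition _ := GRing.Zmodule.on gmod.

Definition gmod_scale (a : group_ring S) (u : gmod) : gmod :=
  \sum_g gm_act g u *~ a g.

Lemma gm_act0 g : gm_act g (0 : gmod) = 0.
Proof.
by apply: (addrI (gm_act g (0 : gmod))); rewrite -gm_actD !addr0.
Qed.

Lemma gm_act_sum g I (r : seq I) (F : I -> gmod) :
  gm_act g (\sum_(i <- r) F i) = \sum_(i <- r) gm_act g (F i).
Proof. exact: (big_morph _ (@gm_actD S M g) (gm_act0 g)). Qed.

Lemma gm_actMz g (u : gmod) z : gm_act g (u *~ z) = gm_act g u *~ z.
Proof.
have actN v : gm_act g (- v : gmod) = - gm_act g v.
  by apply: (addrI (gm_act g v)); rewrite -gm_actD !subrr gm_act0.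
have actn n : gm_act g (u *+ n) = gm_act g u *+ n.
  by elim: n => [|n IH]; rewrite ?mulr0n ?gm_act0 // !mulrS gm_actD IH.
case: z => n; rewrite ?NegzE ?mulrNz -?pmulrn; first exact: actn.
by rewrite actN actn.
Qed.

Lemma gmod_scaleA a b u : gmod_scale a (gmod_scale b u) = gmod_scale (a * b) u.
Proof.
rewrite /gmod_scale; under [RHS]eq_bigr do rewrite ffunE mulrz_sumr.
rewrite [RHS]exchange_big; apply: eq_bigr => h _ /=.
rewrite gm_act_sum mulrz_suml [RHS](reindex_inj (mulgI h)).
apply: eq_bigr => g _ /=; rewrite mulKg gm_actM gm_actMz.
by rewrite -mulrzA mulrC.
Qed.
Lemma gmod_scale1 u : gmod_scale 1 u = u.
Proof.
rewrite /gmod_scale (bigD1 1%g) //= ffunE eqxx gm_act1 big1 ?addr0 // => h.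
by move=> /negPf h1; rewrite ffunE h1.
Qed.
Lemma gmod_scaleDr a : {morph gmod_scale a : u v / u + v}.
Proof.
move=> u v; rewrite -big_split; apply: eq_bigr => g _ /=.
by rewrite gm_actD mulrzDl.
Qed.
Lemma gmod_scaleDl u : {morph gmod_scale^~ u : a b / a + b}.
Proof.
move=> a b; rewrite -big_split; apply: eq_bigr => g _ /=.
by rewrite ffunE mulrzDr.
Qed.

HB.instance Definition _ := GRing.Zmodule_isLmodule.Build (group_ring S) gmod
  gmod_scaleA gmod_scale1 gmod_scaleDr gmod_scaleDl.

Lemma gr_elt_scale g (u : gmod) : gr_elt g *: u = gm_act g u.
Proof.
rewrite /GRing.scale /= /gmod_scale (bigD1 g) //= ffunE eqxx big1 ?addr0 // => h.
by move=> /negPf hg; rewrite ffunE hg.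
Qed.
End GModuleLmod.

Section TrivialModule.
Variables (S : finGroupType) (A : zmodType).
Definition trivial_gmodule : gmodule S :=
  @GModule S A (fun _ u => u) (fun _ => erefl) (fun _ _ _ => erefl)
    (fun _ _ _ => erefl).
Definition trivial_module : lmodType (group_ring S) := gmod trivial_gmodule.
End TrivialModule.

Record gset (S : finGroupType) (X : finType) := GSet {
  gs_act :> S -> X -> X;
  gs_act1 : forall x, gs_act 1%g x = x;
  gs_actM : forall g h x, gs_act (g * h)%g x = gs_act g (gs_act h x)
}.

Section Permutation.
Variables (S : finGroupType) (X : finType) (act : gset S X).

(* {ffun X -> int} is Z[X], the action is determined by g.[x] = [g.x]. *)
Definition perm_act (g : S) (u : {ffun X -> int}) : {ffun X -> int} :=
  [ffun x => u (act g^-1%g x)].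
Lemma perm_act1 u : perm_act 1%g u = u.
Proof. by apply/ffunP => x; rewrite ffunE invg1 gs_act1. Qed.
Lemma perm_actM g h u : perm_act (g * h)%g u = perm_act g (perm_act h u).
Proof. by apply/ffunP => x; rewrite !ffunE invMg gs_actM. Qed.
Lemma perm_actD g : {morph perm_act g : u v / u + v}.
Proof. by move=> u v; apply/ffunP => x; rewrite !ffunE. Qed.
Definition perm_gmodule : gmodule S := GModule perm_act1 perm_actM perm_actD.

Definition augmentation (u : gmod perm_gmodule) : gmod (trivial_gmodule S int) :=
  \sum_x (u : {ffun X -> int}) x.

Lemma augmentation_linear : linear augmentation.
Proof.
move=> a u v; rewrite /augmentation.
under eq_bigr do rewrite ffunE.
rewrite big_split; congr (_ + _); rewrite /GRing.scale /= /gmod_scale.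
under eq_bigr do rewrite sum_ffunE.
rewrite exchange_big; apply: eq_bigr => g _ /=.
rewrite mulrz_suml [RHS](reindex_inj (can_inj (_ : cancel (act g^-1%g) (act g)))).
  apply: eq_bigr => x _ /=.
  have ffunMz (w : {ffun X -> int}) z y : (w *~ z) y = w y *~ z.
    by case: z => n; rewrite ?NegzE ?mulrNz -?pmulrn ?ffunE ffunMnE.
  by rewrite ffunMz ffunE.
by move=> x; rewrite -gs_actM mulgV gs_act1.
Qed.
HB.instance Definition _ := GRing.isLinear.Build (group_ring S)
  (gmod perm_gmodule) (gmod (trivial_gmodule S int)) *:%R
  augmentation augmentation_linear.

Definition Lambda : lmodType (group_ring S) := ker augmentation.

(* Only meaningful for n >= 1. *)
Definition rel_cohomology (n : nat) (A : lmodType (group_ring S)) : zmodType :=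
  Ext n.-1 Lambda A.
End Permutation.

(** * Matched pairs of groups *)

Record matched_pair (G F : finGroupType) := MatchedPair {
  mp_l : G -> F -> F;
  mp_r : G -> F -> G;
  mp_l1 : forall x, mp_l 1%g x = x;
  mp_lM : forall s t x, mp_l (s * t)%g x = mp_l s (mp_l t x);
  mp_r1 : forall s, mp_r s 1%g = s;
  mp_rM : forall s x y, mp_r s (x * y)%g = mp_r (mp_r s x) y;
  mp_l_mul : forall s x y,
    mp_l s (x * y)%g = (mp_l s x * mp_l (mp_r s x) y)%g;
  mp_r_mul : forall s t x,
    mp_r (s * t)%g x = (mp_r s (mp_l t x) * mp_r t x)%g
}.

Section Bowtie.
Variables (G F : finGroupType) (mp : matched_pair G F).
Local Notation "s ▷ x" := (mp_l mp s x) (at level 35).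
Local Notation "s ◁ x" := (mp_r mp s x) (at level 35).

Lemma mp_l_one s : s ▷ 1%g = 1%g.
Proof.
by apply: (mulgI (s ▷ 1)%g); rewrite mulg1 -{2}(mp_r1 mp s) -mp_l_mul mulg1.
Qed.

Lemma mp_r_one x : 1%g ◁ x = 1%g.
Proof.
by apply: (mulIg (1 ◁ x)%g); rewrite mul1g -{1}(mp_l1 mp x) -mp_r_mul mulg1.
Qed.

Definition bowtie of matched_pair G F : Type := (F * G)%type.
Local Notation Sigma := (bowtie mp).
HB.instance Definition _ := Finite.on Sigma.

Definition bt_mul (p q : Sigma) : Sigma :=
  (p.1 * (p.2 ▷ q.1), (p.2 ◁ q.1) * q.2)%g.
Definition bt_one : Sigma := (1, 1)%g.
Definition bt_inv (p : Sigma) : Sigma :=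
  (p.2^-1 ▷ p.1^-1, (p.2 ◁ (p.2^-1 ▷ p.1^-1))^-1)%g.

Lemma bt_mulA : associative bt_mul.
Proof.
move=> [x s] [y t] [z r]; rewrite /bt_mul /=; congr (_, _).
  by rewrite mp_l_mul mp_lM !mulgA.
by rewrite mp_r_mul mp_rM !mulgA.
Qed.
Lemma bt_mul1 : left_id bt_one bt_mul.
Proof. by move=> [x s]; rewrite /bt_mul /= mp_l1 mp_r_one !mul1g. Qed.
Lemma bt_mulV : left_inverse bt_one bt_inv bt_mul.
Proof.
move=> [x s]; rewrite /bt_mul /bt_inv /=.
have sE : (s ◁ (s^-1 ▷ x^-1))^-1%g = s^-1%g ◁ x^-1%g.
  by apply: (mulgI (s ◁ (s^-1 ▷ x^-1))%g); rewrite mulgV -mp_r_mul mulgV mp_r_one.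
rewrite sE -mp_rM -mp_l_mul mulVg mp_l_one mp_r1 mulVg //.
Qed.
HB.instance Definition _ := Finite_isGroup.Build Sigma bt_mulA bt_mul1 bt_mulV.

(* The right action s.(f,g) = (s ◁ f) g on G is turned into a left action
   through inverses. *)
Definition X_act (p : Sigma) (z : F + G) : F + G :=
  match z with
  | inl x => inl (p.1 * (p.2 ▷ x))%g
  | inr s => inr ((s ◁ (p^-1)%g.1) * (p^-1)%g.2)%g
  end.

Lemma X_act1 z : X_act 1%g z = z.
Proof.
by case: z => [x|s]; rewrite /X_act ?invg1 /= ?mp_l1 ?mp_r1 ?mul1g ?mulg1.
Qed.
Lemma X_actM (p q : Sigma) z : X_act (p * q)%g z = X_act p (X_act q z).
Proof.
case: z => [x|s]; rewrite /X_act; first by rewrite /= mp_l_mul mp_lM !mulgA.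
rewrite invMg; move: (p^-1)%g (q^-1)%g => [y t] [x r] /=.
by rewrite mp_rM mp_r_mul mulgA.
Qed.
Definition bowtie_gset : gset Sigma (F + G)%type := GSet X_act1 X_actM.
End Bowtie.

(** * The multiplicative group of a field, written additively *)

Section MultiplicativeGroup.
Variable k : fieldType.

Record kstar : predArgType := KStar { kval : k; kval_neq0 : kval != 0 }.
HB.instance Definition _ := [isSub for kval].
HB.instance Definition _ := [Choice of kstar by <:].

Lemma kval_inj : injective kval. Proof. exact: val_inj. Qed.

Definition kstar1 : kstar := KStar (oner_neq0 k).
Lemma kstarV_subproof (u : kstar) : (kval u)^-1 != 0.
Proof. by rewrite invr_eq0 kval_neq0. Qed.
Definition kstarV (u : kstar) : kstar := KStar (kstarV_subproof u).
Lemma kstarM_subproof (u v : kstar) : kval u * kval v != 0.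
Proof. by rewrite mulf_neq0 ?kval_neq0. Qed.
Definition kstarM (u v : kstar) : kstar := KStar (kstarM_subproof u v).

Lemma kstarMA : associative kstarM.
Proof. by move=> u v w; apply: val_inj; rewrite /= mulrA. Qed.
Lemma kstarMC : commutative kstarM.
Proof. by move=> u v; apply: val_inj; rewrite /= mulrC. Qed.
Lemma kstar1M : left_id kstar1 kstarM.
Proof. by move=> u; apply: val_inj; rewrite /= mul1r. Qed.
Lemma kstarVM : left_inverse kstar1 kstarV kstarM.
Proof. by move=> u; apply: val_inj; rewrite /= mulVf ?kval_neq0. Qed.
HB.instance Definition _ :=
  GRing.isZmodule.Build kstar kstarMA kstarMC kstar1M kstarVM.

Lemma kval0 : kval 0 = 1. Proof. by []. Qed.
Lemma kvalD u v : kval (u + v) = kval u * kval v. Proof. by []. Qed.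
Lemma kvalN u : kval (- u) = (kval u)^-1. Proof. by []. Qed.
End MultiplicativeGroup.

(** * Finite-dimensional bialgebras given on a basis *)

Section BasedBialgebra.
Variable k : fieldType.

Notation vec B := {ffun B -> k^o}.

Definition basis (B : finType) (b : B) : vec B := [ffun c => (c == b)%:R].

Lemma vecE (B : finType) (u : vec B) : u = \sum_b u b *: basis b.
Proof.
apply/ffunP => c; rewrite sum_ffunE (bigD1 c) //= big1 ?addr0.
  by rewrite !ffunE eqxx; exact: (esym (mulr1 _)).
by move=> b /negPf bc; rewrite !ffunE eq_sym bc; exact: mulr0.
Qed.

(* Structure constants with respect to the basis B; no axiom is imposed. *)
Record bialgebra (B : finType) := Bialgebra {
  ba_mul : B -> B -> vec B;
  ba_one : vec B;
  ba_comul : B -> vec (B * B)%type;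
  ba_counit : B -> k
}.

Section Operations.
Variables (B : finType) (H : bialgebra B).

Definition hmul (u v : vec B) : vec B :=
  \sum_a \sum_b (u a * v b) *: ba_mul H a b.
Definition hcomul (u : vec B) : vec (B * B)%type :=
  \sum_b u b *: ba_comul H b.
Definition hcounit (u : vec B) : k := \sum_b u b * ba_counit H b.
End Operations.

Definition tensor (B C : finType) (u : vec B) (v : vec C) : vec (B * C)%type :=
  [ffun c => u c.1 * v c.2].

Definition tensor_map (B B' C C' : finType)
    (f : vec B -> vec B') (g : vec C -> vec C') (w : vec (B * C)%type) :
    vec (B' * C')%type :=
  \sum_c w c *: tensor (f (basis c.1)) (g (basis c.2)).

(* Preservation of antipodes is automatic for bialgebra maps between Hopf
   algebras. *)
Record hopf_hom (B B' : finType) (H : bialgebra B) (H' : bialgebra B')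
    (f : {linear vec B -> vec B'}) : Prop := HopfHom {
  hopf_homM : forall u v, f (hmul H u v) = hmul H' (f u) (f v);
  hopf_hom1 : f (ba_one H) = ba_one H';
  hopf_hom_comul : forall u, hcomul H' (f u) = tensor_map f f (hcomul H u);
  hopf_hom_counit : forall u, hcounit H' (f u) = hcounit H u
}.
End BasedBialgebra.
Notation vec k B := {ffun B -> k^o}.

(** * Opext *)

Section Opext.
Variables (k : fieldType) (G F : finGroupType) (mp : matched_pair G F).
Local Notation "s ▷ x" := (mp_l mp s x) (at level 35).
Local Notation "s ◁ x" := (mp_r mp s x) (at level 35).

(* Pairs (sigma, tau), with sigma(s;x,y) = p.1 (s, x, y) and
   tau(s,t;x) = p.2 (s, t, x); addition is pointwise multiplication in k^*. *)
Definition cochain_pair : zmodType :=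
  ({ffun G * F * F -> kstar k} * {ffun G * G * F -> kstar k})%type.

Definition sigma (p : cochain_pair) (s : G) (x y : F) : k := kval (p.1 (s, x, y)).
Definition tau (p : cochain_pair) (s t : G) (x : F) : k := kval (p.2 (s, t, x)).

Record is_datum (p : cochain_pair) : Prop := IsDatum {
  sigma_norm : forall s x y, x = 1%g \/ y = 1%g -> sigma p s x y = 1;
  tau_norm : forall s t x, s = 1%g \/ t = 1%g -> tau p s t x = 1;
  sigma_cocycle : forall s x y z,
    sigma p (s ◁ x) y z * sigma p s x (y * z)%g =
    sigma p s x y * sigma p s (x * y)%g z;
  tau_cocycle : forall s t r x,
    tau p (s * t)%g r x * tau p s t (r ▷ x) =
    tau p s (t * r)%g x * tau p t r x;
  sigma_tau_compat : forall s t x y,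
    sigma p (s * t)%g x y * tau p s t (x * y)%g =
    sigma p s (t ▷ x) ((t ◁ x) ▷ y) * sigma p t x y *
      tau p s t x * tau p (s ◁ (t ▷ x)) (t ◁ x) y
}.

Definition datum_pred : {pred cochain_pair} := fun p => `[< is_datum p >].

Lemma sigma0 s x y : sigma 0 s x y = 1. Proof. by rewrite /sigma ffunE. Qed.
Lemma tau0 s t x : tau 0 s t x = 1. Proof. by rewrite /tau ffunE. Qed.
Lemma sigmaB p q s x y : sigma (p - q) s x y = sigma p s x y / sigma q s x y.
Proof. by rewrite /sigma !ffunE. Qed.
Lemma tauB p q s t x : tau (p - q) s t x = tau p s t x / tau q s t x.
Proof. by rewrite /tau !ffunE. Qed.

Lemma datum_zmod_closed : zmod_closed datum_pred.
Proof.
split=> [|p q]; rewrite !unfold_in /datum_pred.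
  by apply/asboolP; split=> *; rewrite ?sigma0 ?tau0 ?mulr1.
move=> /asboolP[p1 p2 p3 p4 p5] /asboolP[q1 q2 q3 q4 q5].
apply/asboolP; split=> *; rewrite ?sigmaB ?tauB.
- by rewrite p1 // q1 // divr1.
- by rewrite p2 // q2 // divr1.
- by rewrite !mulf_div p3 q3.
- by rewrite !mulf_div p4 q4.
- by rewrite !mulf_div p5 q5.
Qed.
HB.instance Definition _ :=
  GRing.isZmodClosed.Build cochain_pair datum_pred datum_zmod_closed.

Record datum : predArgType :=
  Datum { datum_val :> cochain_pair; _ : datum_val \in datum_pred }.
HB.instance Definition _ := [isSub for datum_val].
HB.instance Definition _ := [Choice of datum by <:].
HB.instance Definition _ := [SubChoice_isSubZmodule of datum by <:].

(* e_s # x is [basis k (s, x)]. *)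
Local Notation e_ s x := (basis k (s, x)).

(* The unit and the counit are forced by the product and the coproduct. *)
Definition bicrossed (p : datum) : bialgebra k (G * F)%type := {|
  ba_mul := fun a b =>
    if a.1 ◁ a.2 == b.1 then sigma p a.1 a.2 b.2 *: e_ a.1 (a.2 * b.2)%g else 0;
  ba_one := \sum_s e_ s 1%g;
  ba_comul := fun c => \sum_(ab : G * G | (ab.1 * ab.2)%g == c.1)
    tau p ab.1 ab.2 c.2 *: tensor (e_ ab.1 (ab.2 ▷ c.2)) (e_ ab.2 c.2);
  ba_counit := fun c => (c.1 == 1%g)%:R
|}.

Definition ext_i (phi : vec k G) : vec k (G * F)%type := \sum_s phi s *: e_ s 1%g.
Definition ext_pi (u : vec k (G * F)%type) : vec k F :=
  \sum_c u c *: (if c.1 == 1%g then basis k c.2 else 0).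

Definition ext_equiv (p q : datum) : Prop :=
  exists f : {linear vec k (G * F)%type -> vec k (G * F)%type},
    [/\ hopf_hom (bicrossed p) (bicrossed q) f,
        forall phi, f (ext_i phi) = ext_i phi
      & forall u, ext_pi (f u) = ext_pi u].

(** ** An equivalence of extensions rescales every basis vector *)

Lemma basisE (B : finType) (b c : B) : basis k b c = (c == b)%:R.
Proof. by rewrite ffunE. Qed.

Lemma sum_vecE (B I : finType) (P : pred I) (E : I -> vec k B) c :
  (\sum_(i | P i) E i) c = \sum_(i | P i) E i c.
Proof. by rewrite sum_ffunE. Qed.

Lemma scale_vecE (B : finType) (a : k) (u : vec k B) c : (a *: u) c = a * u c.
Proof. by rewrite ffunE. Qed.

Lemma sum_basis (B : finType) (V : lmodType k) (b : B) (E : B -> V) :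
  \sum_c (basis k b c : k) *: E c = E b.
Proof.
rewrite (bigD1 b) //= basisE eqxx scale1r big1 ?addr0 // => c /negPf cb.
by rewrite basisE cb scale0r.
Qed.

Lemma hmul_basis (B : finType) (H : bialgebra k B) a b :
  hmul H (basis k a) (basis k b) = ba_mul H a b.
Proof.
rewrite /hmul; under eq_bigr => c _.
  under eq_bigr do rewrite -scalerA.
  rewrite -scaler_sumr sum_basis.
over.
exact: sum_basis.
Qed.

Lemma hcomul_basis (B : finType) (H : bialgebra k B) b :
  hcomul H (basis k b) = ba_comul H b.
Proof. exact: sum_basis. Qed.

Lemma ext_i_basis s : ext_i (basis k s) = e_ s 1%g.
Proof. exact: sum_basis. Qed.

Lemma ext_piE (u : vec k (G * F)%type) y : ext_pi u y = u (1%g, y).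
Proof.
rewrite /ext_pi sum_vecE (bigD1 (1%g, y)) //= eqxx scale_vecE basisE eqxx mulr1.
rewrite big1 ?addr0 // => -[s x] /negPf sxy; rewrite scale_vecE /=.
move: sxy; rewrite xpair_eqE; case: eqP => _ /=.
  by move=> xy; rewrite basisE eq_sym xy mulr0.
by rewrite ffunE mulr0.
Qed.

Lemma bicrossed_mulE p s x y :
  ba_mul (bicrossed p) (s, x) (s ◁ x, y) = sigma p s x y *: e_ s (x * y)%g.
Proof. by rewrite /= eqxx. Qed.

Lemma bicrossed_comulE p c (d : (G * F) * (G * F)) :
  ba_comul (bicrossed p) c d =
  if [&& (d.1.1 * d.2.1)%g == c.1, d.1.2 == d.2.1 ▷ c.2 & d.2.2 == c.2]
  then tau p d.1.1 d.2.1 c.2 else 0.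
Proof.
case: c d => [s x] [[a y] [b z]] /=; rewrite sum_vecE.
have E (ab : G * G) : (tau p ab.1 ab.2 x *:
    tensor (e_ ab.1 (ab.2 ▷ x)) (e_ ab.2 x)) (a, y, (b, z)) =
    tau p ab.1 ab.2 x * ((ab == (a, b)) && (y == b ▷ x) && (z == x))%:R.
  rewrite scale_vecE ffunE /= !basisE -natrM mulnb; congr (_ * _%:R); congr nat_of_bool.
  case: ab => a' b' /=; rewrite !xpair_eqE (eq_sym a') (eq_sym b').
  by case: (eqVneq b b') => [<-|_]; case: (a == a'); rewrite ?andbT ?andbF.
under eq_bigr do rewrite E.
case: (boolP ((a * b)%g == s)) => abs /=; last first.
  rewrite big1 // => -[a' b'] /eqP /= abs'.
  rewrite xpair_eqE; case: eqP => [a'E|_] /=; last by rewrite mulr0.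
  case: eqP => [b'E|_] /=; last by rewrite mulr0.
  by rewrite -a'E -b'E abs' eqxx in abs.
rewrite (bigD1 (a, b)) //= eqxx big1 => [|ab /andP[_ /negPf ->]]; last by rewrite mulr0.
by rewrite addr0 /=; case: andb; rewrite ?mulr1 ?mulr0.
Qed.

(* e_s # 1 projects onto the span of the e_s # x. *)
Lemma bicrossed_mul_e p s u c :
  hmul (bicrossed p) (e_ s 1%g) u c = if c.1 == s then u c else 0.
Proof.
have [/asboolP[sn _ _ _ _]] : datum_val p \in datum_pred by case: (p).
rewrite /hmul; under eq_bigr => a _.
  under eq_bigr do rewrite -scalerA.
  rewrite -scaler_sumr.
over.
rewrite sum_basis sum_vecE /=.
under eq_bigr => b _.
  rewrite mp_r1 scale_vecE.
over.
case: c => t y /=; case: (eqVneq t s) => [->|ts].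
  rewrite (bigD1 (s, y)) //= eqxx scale_vecE sn; last by left.
  rewrite mul1g basisE eqxx !mulr1 big1 ?addr0 // => -[s' y'] /negPf /=.
  rewrite xpair_eqE (eq_sym s'); case: eqP => _ /= yy; last by rewrite ffunE mulr0.
  by rewrite mul1g scale_vecE basisE xpair_eqE (eq_sym y) yy andbF !mulr0.
rewrite big1 // => -[s' y'] _ /=; case: eqP => _; last by rewrite ffunE mulr0.
by rewrite scale_vecE basisE xpair_eqE (negPf ts) !mulr0.
Qed.

Lemma bicrossed_comul_pi p u b y :
  hcomul (bicrossed p) u (b, (1%g, y)) = u b * (b.2 == y)%:R.
Proof.
have [/asboolP[_ tn _ _ _]] : datum_val p \in datum_pred by case: (p).
rewrite /hcomul sum_vecE.
under eq_bigr do rewrite scale_vecE bicrossed_comulE /= mulg1 mp_l1.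
rewrite (bigD1 b) //= big1 => [|c /negPf cb]; last first.
  case: (boolP [&& _, _ & _]) => [/and3P[/eqP b1 /eqP b2 _]|_]; last exact: mulr0.
  by move: cb; rewrite [c]surjective_pairing -b1 -b2 -surjective_pairing eqxx.
rewrite addr0 !eqxx /= eq_sym; congr (_ * _).
by case: eqP => // _; rewrite tn //; right.
Qed.

(* The equivalences send e_s # x to v(s,x) e_s # x. *)
Definition gauge : zmodType := {ffun G * F -> kstar k}.

Definition gauge_normal (v : gauge) : Prop :=
  (forall s, v (s, 1%g) = 0) /\ (forall x, v (1%g, x) = 0).

Definition gauge_d (v : gauge) : cochain_pair :=
  ([ffun a : G * F * F =>
      v (a.1.1, a.1.2) + v (a.1.1 ◁ a.1.2, a.2) - v (a.1.1, (a.1.2 * a.2)%g)],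
   [ffun a : G * G * F =>
      v ((a.1.1 * a.1.2)%g, a.2) - v (a.1.1, a.1.2 ▷ a.2) - v (a.1.2, a.2)]).

Lemma gauge_d_zmod_morphism : zmod_morphism gauge_d.
Proof.
have subACA (A : zmodType) (a b c d : A) : a - b - (c - d) = a - c - (b - d).
  by rewrite !opprD !opprK addrACA.
move=> v w; congr (_, _); apply/ffunP => a; rewrite !ffunE.
  by rewrite [RHS]subACA; congr (_ - _); rewrite opprD addrACA.
by rewrite [RHS]subACA; congr (_ - _); rewrite subACA.
Qed.

Lemma gauge_dE1 v s x y :
  kval ((gauge_d v).1 (s, x, y)) =
  kval (v (s, x)) * kval (v (s ◁ x, y)) / kval (v (s, (x * y)%g)).
Proof. by rewrite ffunE. Qed.

Lemma gauge_dE2 v s t x :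
  kval ((gauge_d v).2 (s, t, x)) =
  kval (v ((s * t)%g, x)) / kval (v (s, t ▷ x)) / kval (v (t, x)).
Proof. by rewrite ffunE. Qed.

Section Rescaling.
Variables (p q : datum) (f : {linear vec k (G * F)%type -> vec k (G * F)%type}).
Hypothesis f_hopf : hopf_hom (bicrossed p) (bicrossed q) f.
Hypothesis f_i : forall phi, f (ext_i phi) = ext_i phi.
Hypothesis f_pi : forall u, ext_pi (f u) = ext_pi u.

Lemma resc_e s : f (e_ s 1%g) = e_ s 1%g.
Proof. by rewrite -ext_i_basis f_i. Qed.

Lemma resc_diag b c : c != b -> f (basis k b) c = 0.
Proof.
case: b => s x; case: c => t y tysx.
have [ts|ts] := eqVneq t s; last first.
  have := hopf_homM f_hopf (e_ s 1%g) (e_ s x).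
  have -> : hmul (bicrossed p) (e_ s 1%g) (e_ s x) = e_ s x.
    apply/ffunP => c; rewrite bicrossed_mul_e basisE.
    case: (eqVneq c.1 s) => // cs; case: eqP => // cE.
    by rewrite cE eqxx in cs.
  by rewrite resc_e => ->; rewrite bicrossed_mul_e /= (negPf ts).
have xy : (x == y) = false.
  by apply/negP => /eqP xy; move: tysx; rewrite ts xy eqxx.
have := congr1 (fun w : vec k _ => w ((t, y), (1%g, y)))
  (hopf_hom_comul f_hopf (e_ s x)).
rewrite bicrossed_comul_pi /= eqxx mulr1 => ->.
rewrite /tensor_map sum_vecE big1 // => -[c1 [t2 y2]] _.
rewrite scale_vecE ffunE /=.
have -> : f (e_ t2 y2) (1%g, y) = e_ t2 y2 (1%g, y).
  by rewrite -!ext_piE f_pi.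
rewrite basisE; case: eqP => [[<- <-]|_]; last by rewrite !mulr0.
rewrite bicrossed_comul_pi basisE.
case: eqP => [->|_]; first by rewrite /= xy mulr0 mul0r.
by rewrite !mul0r.
Qed.

Lemma resc_basis b : f (basis k b) = f (basis k b) b *: basis k b.
Proof.
apply/ffunP => c; rewrite scale_vecE basisE.
by case: eqVneq => [->|cb]; rewrite ?mulr1 // resc_diag ?mulr0.
Qed.

Lemma resc_mul s x y :
  sigma p s x y * f (e_ s (x * y)%g) (s, (x * y)%g) =
  f (e_ s x) (s, x) * f (e_ (s ◁ x) y) (s ◁ x, y) * sigma q s x y.
Proof.
have := hopf_homM f_hopf (e_ s x) (e_ (s ◁ x) y).
rewrite hmul_basis bicrossed_mulE linearZ /=.
rewrite (resc_basis (s, x)) (resc_basis (_, y)).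
have hmulZ a b u v : hmul (bicrossed q) (a *: u) (b *: v) =
    (a * b) *: hmul (bicrossed q) u v.
  rewrite /hmul scaler_sumr; apply: eq_bigr => c _.
  rewrite scaler_sumr; apply: eq_bigr => d _.
  by rewrite !scale_vecE scalerA mulrACA.
rewrite hmulZ hmul_basis bicrossed_mulE.
move=> /(congr1 (fun w : vec k _ => w (s, (x * y)%g))).
by rewrite !scale_vecE !basisE !eqxx !mulr1.
Qed.

Lemma resc_comul s t x :
  tau q s t x * f (e_ (s * t)%g x) ((s * t)%g, x) =
  tau p s t x * (f (e_ s (t ▷ x)) (s, t ▷ x) * f (e_ t x) (t, x)).
Proof.
set c := f (e_ (s * t)%g x) _.
have := congr1 (fun w : vec k _ => w ((s, t ▷ x), (t, x)))
  (hopf_hom_comul f_hopf (e_ (s * t)%g x)).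
rewrite (resc_basis ((s * t)%g, x)) -/c hcomul_basis.
rewrite {1}/hcomul; under eq_bigr do rewrite scale_vecE -scalerA.
have comulE r : ba_comul (bicrossed r) ((s * t)%g, x) ((s, t ▷ x), (t, x)) =
    tau r s t x by rewrite bicrossed_comulE /= !eqxx.
rewrite -scaler_sumr sum_basis scale_vecE comulE mulrC => ->; rewrite /tensor_map sum_vecE.
rewrite (bigD1 ((s, t ▷ x), (t, x))) // big1 ?addr0 => [|[c1 c2]].
  by rewrite scale_vecE comulE ffunE [LHS]addr0.
rewrite /= xpair_eqE negb_and scale_vecE ffunE /= => /orP[] h.
  by rewrite resc_diag ?mul0r ?mulr0 // eq_sym.
by rewrite [X in _ * X]mulrC resc_diag ?mul0r ?mulr0 // eq_sym.
Qed.

Lemma resc_neq0 b : f (basis k b) b != 0.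
Proof.
case: b => s x; apply/eqP => f0.
have := resc_mul s x x^-1%g.
rewrite mulgV resc_e basisE eqxx mulr1 f0 !mul0r => /eqP.
by rewrite (negPf (kval_neq0 _)).
Qed.

Lemma resc_gauge :
  exists v : gauge, gauge_normal v /\ datum_val (p - q) = gauge_d v.
Proof.
exists [ffun b => @KStar k _ (resc_neq0 b)]; split; first split.
- by move=> s; apply: kval_inj; rewrite ffunE /= resc_e basisE eqxx.
- move=> x; apply: kval_inj; rewrite ffunE /= -ext_piE f_pi ext_piE.
  by rewrite basisE eqxx.
congr (_, _); apply/ffunP => -[[s x] y]; apply: kval_inj.
  rewrite gauge_dE1 !ffunE /=.
  apply/eqP; rewrite eqr_div ?kval_neq0 ?resc_neq0 //.
  by apply/eqP; exact: resc_mul.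
rewrite gauge_dE2 !ffunE /= -mulrA -invfM.
apply/eqP; rewrite eqr_div ?kval_neq0 ?mulf_neq0 ?resc_neq0 //.
by rewrite -resc_comul mulrC.
Qed.
End Rescaling.

Section RescaleBy.
Variables (p q : datum) (v : gauge).
Hypothesis v_normal : gauge_normal v.
Hypothesis pq_v : datum_val (p - q) = gauge_d v.

Definition rescale (u : vec k (G * F)%type) : vec k (G * F)%type :=
  [ffun b => kval (v b) * u b].

Lemma rescale_linear : linear rescale.
Proof.
move=> a u w; apply/ffunP => b; rewrite !ffunE mulrDr; congr (_ + _).
exact: mulrCA.
Qed.
HB.instance Definition _ := GRing.isLinear.Build k (vec k (G * F)%type)
  (vec k (G * F)%type) *:%R rescale rescale_linear.

Lemma rescale_basis b : rescale (basis k b) = (kval (v b) : k) *: basis k b.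
Proof.
apply/ffunP => c; rewrite !ffunE.
by case: eqVneq => [->|_]; rewrite ?mulr0 //; exact/esym/mulr0.
Qed.

Lemma rescale_mul s x y :
  sigma p s x y * kval (v (s, (x * y)%g)) =
  kval (v (s, x)) * kval (v (s ◁ x, y)) * sigma q s x y.
Proof.
apply/eqP; rewrite -eqr_div ?kval_neq0 //.
by rewrite -gauge_dE1 -pq_v -sigmaB.
Qed.

Lemma rescale_comul s t x :
  tau q s t x * kval (v ((s * t)%g, x)) =
  tau p s t x * (kval (v (s, t ▷ x)) * kval (v (t, x))).
Proof.
rewrite mulrC; apply/esym/eqP.
rewrite -eqr_div ?kval_neq0 ?mulf_neq0 ?kval_neq0 //.
by rewrite invfM mulrA -gauge_dE2 -pq_v -tauB.
Qed.

Lemma rescale_i phi : rescale (ext_i phi) = ext_i phi.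
Proof.
rewrite /ext_i raddf_sum; apply: eq_bigr => s _.
by rewrite /= linearZ /= rescale_basis v_normal.1 kval0 scale1r.
Qed.

Lemma rescale_pi u : ext_pi (rescale u) = ext_pi u.
Proof. by apply/ffunP => y; rewrite !ext_piE ffunE v_normal.2 kval0 mul1r. Qed.

Lemma rescale_tensor w c1 c2 :
  tensor_map rescale rescale w (c1, c2) =
  w (c1, c2) * (kval (v c1) * kval (v c2)).
Proof.
rewrite /tensor_map sum_vecE (bigD1 (c1, c2)) // big1 => [|[d1 d2]]; last first.
  rewrite /= xpair_eqE negb_and scale_vecE ffunE !rescale_basis !scale_vecE !basisE.
  by case/orP => /negPf; rewrite eq_sym => ->; rewrite !(mulr0, mul0r).
rewrite [LHS]addr0 scale_vecE ffunE !rescale_basis !scale_vecE !basisE.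
by rewrite !eqxx !mulr1.
Qed.

Lemma rescale_hopf : hopf_hom (bicrossed p) (bicrossed q) rescale.
Proof.
split.
- move=> u w; rewrite /hmul raddf_sum; apply: eq_bigr => -[s x] _ /=.
  rewrite raddf_sum; apply: eq_bigr => -[t y] _ /=.
  rewrite linearZ /= !ffunE.
  case: eqP => [<-|_]; last by rewrite linear0 !scaler0.
  rewrite linearZ /= rescale_basis !scalerA; congr (_ *: _).
  rewrite -[LHS]mulrA rescale_mul.
  by rewrite mulrA; congr (_ * _); rewrite mulrC mulrACA.
- rewrite /= raddf_sum; apply: eq_bigr => s _.
  by rewrite /= rescale_basis v_normal.1 kval0 scale1r.
- move=> u; apply/ffunP => -[c1 c2].
  rewrite rescale_tensor.
  rewrite /hcomul !sum_vecE mulr_suml; apply: eq_bigr => -[s x] _.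
  rewrite !scale_vecE !bicrossed_comulE ffunE /=.
  case: c1 c2 => [a y] [b z] /=.
  case: (boolP [&& _, _ & _]) => [/and3P[/eqP <- /eqP -> /eqP ->]|_]; last first.
    by rewrite !mulr0 mul0r.
  by rewrite [X in X * _]mulrC -!mulrA; congr (_ * _); rewrite -rescale_comul mulrC.
- move=> u; apply: eq_bigr => -[s x] _ /=; rewrite ffunE.
  by case: eqP => [->|_]; rewrite ?mulr0 // v_normal.2 kval0 mul1r.
Qed.
End RescaleBy.

Lemma ext_equivP p q :
  ext_equiv p q <->
  exists v : gauge, gauge_normal v /\ datum_val (p - q) = gauge_d v.
Proof.
split=> [[f [fH fi fpi]]|[v [vn pqv]]]; first exact: (@resc_gauge _ _ f).
exists (rescale v); split; first exact: rescale_hopf.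
  exact: rescale_i.
exact: rescale_pi.
Qed.

HB.instance Definition _ :=
  GRing.isZmodMorphism.Build gauge cochain_pair gauge_d gauge_d_zmod_morphism.

Lemma gauge_normal0 : gauge_normal 0.
Proof. by split=> *; rewrite ffunE. Qed.
Lemma gauge_normalN v : gauge_normal v -> gauge_normal (- v).
Proof. by case=> v1 v2; split=> *; rewrite ffunE ?v1 ?v2 oppr0. Qed.
Lemma gauge_normalD v w :
  gauge_normal v -> gauge_normal w -> gauge_normal (v + w).
Proof.
by case=> v1 v2 [w1 w2]; split=> *; rewrite ffunE ?v1 ?v2 ?w1 ?w2 addr0.
Qed.

Lemma datum_valD p q : datum_val (p + q) = datum_val p + datum_val q.
Proof. exact: (raddfD (\val : datum -> cochain_pair)). Qed.
Lemma datum_valN p : datum_val (- p) = - datum_val p.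
Proof. exact: (raddfN (\val : datum -> cochain_pair)). Qed.

Lemma ext_equiv_refl p : ext_equiv p p.
Proof.
apply/ext_equivP; exists 0; split; first exact: gauge_normal0.
by rewrite subrr raddf0.
Qed.

Lemma ext_equiv_sym p q : ext_equiv p q -> ext_equiv q p.
Proof.
move=> /ext_equivP[v [vn vE]]; apply/ext_equivP; exists (- v).
by rewrite raddfN /= -vE opprB; split=> //; exact: gauge_normalN.
Qed.

Lemma ext_equiv_trans p q r : ext_equiv p q -> ext_equiv q r -> ext_equiv p r.
Proof.
move=> /ext_equivP[v [vn vE]] /ext_equivP[w [wn wE]]; apply/ext_equivP.
exists (v + w); split; first exact: gauge_normalD.
by rewrite raddfD /= -vE -wE addrA subrK.
Qed.

Lemma ext_equivD p p' q q' :
  ext_equiv p q -> ext_equiv p' q' -> ext_equiv (p + p') (q + q').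
Proof.
move=> /ext_equivP[v [vn vE]] /ext_equivP[w [wn wE]]; apply/ext_equivP.
exists (v + w); split; first exact: gauge_normalD.
by rewrite [gauge_d _]raddfD /= -vE -wE !datum_valD opprD addrACA.
Qed.

Lemma ext_equivN p q : ext_equiv p q -> ext_equiv (- p) (- q).
Proof.
move=> /ext_equivP[v [vn vE]]; apply/ext_equivP; exists (- v).
rewrite -opprD datum_valN vE raddfN.
by split=> //; exact: gauge_normalN.
Qed.

Definition ext_rel : rel datum := fun p q => `[< ext_equiv p q >].

Lemma ext_rel_is_equiv : equiv_class_of ext_rel.
Proof.
split=> [p|p q|q p r]; rewrite /ext_rel.
- exact/asboolP/ext_equiv_refl.
- by apply/asboolP/asboolP; exact: ext_equiv_sym.
- by move=> /asboolP pq /asboolP qr; apply/asboolP; exact: ext_equiv_trans pq qr.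
Qed.
Canonical ext_rel_equiv := EquivRelPack ext_rel_is_equiv.
Canonical ext_rel_encModRel := defaultEncModRel ext_rel.

Local Open Scope quotient_scope.

Definition Opext := {eq_quot ext_rel}.
HB.instance Definition _ : EqQuotient datum ext_rel Opext := EqQuotient.on Opext.
HB.instance Definition _ := Choice.on Opext.

Definition ext_class : datum -> Opext := \pi.

Lemma ext_classP p q : ext_class p = ext_class q <-> ext_equiv p q.
Proof.
split=> [/eqP|pq]; first by rewrite piE => /asboolP.
by apply/eqP; rewrite piE; apply/asboolP.
Qed.

Lemma ext_repr p : ext_equiv (generic_quotient.repr (ext_class p)) p.
Proof. by apply/ext_classP; rewrite /ext_class reprK. Qed.

Definition opext_zero : Opext := ext_class 0.
Definition opext_opp (a : Opext) : Opext := ext_class (- generic_quotient.repr a).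
Definition opext_add (a b : Opext) : Opext :=
  ext_class (generic_quotient.repr a + generic_quotient.repr b).

Lemma ext_classN p : ext_class (- p) = opext_opp (ext_class p).
Proof. by apply/esym/ext_classP/ext_equivN/ext_repr. Qed.
Lemma ext_classD p q : ext_class (p + q) = opext_add (ext_class p) (ext_class q).
Proof. by apply/esym/ext_classP/ext_equivD; apply/ext_repr. Qed.

Lemma ext_class_surj (a : Opext) : exists p, a = ext_class p.
Proof. by exists (generic_quotient.repr a); rewrite /ext_class reprK. Qed.

Lemma opext_addA : associative opext_add.
Proof.
move=> a b c; have [[p ->] [q ->] [r ->]] :=
  And3 (ext_class_surj a) (ext_class_surj b) (ext_class_surj c).
by rewrite -!ext_classD addrA.
Qed.
Lemma opext_addC : commutative opext_add.
Proof. by move=> a b; rewrite /opext_add addrC. Qed.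
Lemma opext_add0 : left_id opext_zero opext_add.
Proof. by move=> a; have [p ->] := ext_class_surj a; rewrite -ext_classD add0r. Qed.
Lemma opext_addN : left_inverse opext_zero opext_opp opext_add.
Proof.
by move=> a; have [p ->] := ext_class_surj a;
   rewrite -ext_classN -ext_classD addNr.
Qed.
HB.instance Definition _ :=
  GRing.isZmodule.Build Opext opext_addA opext_addC opext_add0 opext_addN.
End Opext.

(* Main.v *)
Require Import Defs.
From HB Require Import structures.
From mathcomp Require Import all_boot all_order all_fingroup all_algebra.
From mathcomp Require Import boolp finmap monalg.

Set Implicit Arguments.
Unset Strict Implicit.
Unset Printing Implicit Defensive.
Import GRing.Theory.
Local Open Scope ring_scope.

(** Write Sigma for the bicrossed product of F and G, A for the trivial module,
    and identify F with Sigma / G and G with Sigma / F as Sigma-sets.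

    Sigma acts simply transitively on F x G, so Z[F x G] is free of rank one; the
    map [x, s] |-> x - s sends it onto Lambda, with kernel the elements both of
    whose marginals vanish.  This kernel is the image of the free module
    Z[F^2 x G^2] under the product of the two simplicial boundaries,
      [x0, x1; s0, s1] |-> [x1, s1] - [x0, s1] - [x1, s0] + [x0, s0].
    With K the kernel of the latter map, 0 -> K -> Z[F^2 x G^2] -> Z[F x G] ->
    Lambda -> 0 is exact with free middle terms ([bowtie_two_step]), hence
      Ext^2(Lambda, A) = Hom(K, A) / (restrictions of Hom(Z[F^2 x G^2], A));
    [two_step_comparison] transports this description to the standard resolution.

    An additive map on Z[F^2 x G^2] is a function w on F^2 x G^2.  Its restriction
    to K depends exactly on the two simplicial differentials dF w on F^3 x G^2 and
    dG w on F^2 x G^3 ([d_closedP]), and the restriction is Sigma-linear exactly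
    when dF w and dG w are Sigma-invariant ([equivariantP]).  Every linear map on K
    arises in this way ([restr_surj]), because K is a direct summand of the abelian
    group Z[F^2 x G^2].  So a linear map on K is a pair of invariant functions of
    the form (dF w, dG w).

    Moving (x0, s_last) to (1, 1) by Sigma, an invariant function on F^3 x G^2 is
    the same as a function of (s; x, y), an invariant function on F^2 x G^3 the
    same as a function of (s, t; x), and an invariant function on F^2 x G^2 the same
    as a function of (s; x).  Under this dictionary the simplicial identities for
    (dF w, dG w) are the two cocycle conditions and the compatibility of
    (sigma, tau), up to the sign of tau; conversely every such pair is
    (dF w, dG w) for an explicit w ([primitive]), by the usual contraction of the
    simplicial complexes at the base points.  The invariant w give the coboundaries
    of the functions v(s; x), which are the equivalences of extensions.  Finally,
    every class contains a normalized pair, and a function v with normalized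
    coboundary is itself normalized ([normalize], [normalized_gauge]). *)

(** * Identities in abelian groups *)

(** Linear identities in an abstract abelian group are decided by comparing the
    integer coefficients of the atoms; [zmod] reifies both sides into [zexpr]. *)
Inductive zexpr :=
  ZVar of nat | ZZero | ZAdd of zexpr & zexpr | ZOpp of zexpr.

Fixpoint zcoef (e : zexpr) (i : nat) : int :=
  match e with
  | ZVar n => if i == n then 1 else 0
  | ZZero => 0
  | ZAdd e1 e2 => zcoef e1 i + zcoef e2 i
  | ZOpp e1 => - zcoef e1 i
  end.

Section Zmod.
Variables (V : zmodType) (env : seq V).

Fixpoint zeval (e : zexpr) : V :=
  match e with
  | ZVar n => nth 0 env n
  | ZZero => 0
  | ZAdd e1 e2 => zeval e1 + zeval e2
  | ZOpp e1 => - zeval e1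
  end.

Lemma zevalE e : zeval e = \sum_(i < size env) env`_i *~ zcoef e i.
Proof.
elim: e => [n||e1 IH1 e2 IH2|e IH] /=.
- case: (ltnP n (size env)) => n_env.
    rewrite (bigD1 (Ordinal n_env)) //= eqxx big1 ?addr0 // => i.
    by rewrite -val_eqE /= => /negPf ->.
  rewrite nth_default // big1 // => i _; case: eqP => // i_n.
  by move: (ltn_ord i); rewrite i_n ltnNge n_env.
- by rewrite big1.
- by rewrite IH1 IH2 -big_split; apply: eq_bigr => i _; rewrite mulrzDr.
- by rewrite IH -sumrN; apply: eq_bigr => i _; rewrite mulrNz.
Qed.

Lemma zeval_eq e1 e2 :
  all (fun i => zcoef e1 i == zcoef e2 i) (iota 0 (size env)) ->
  zeval e1 = zeval e2.
Proof.
move=> /allP e12; rewrite !zevalE; apply: eq_bigr => i _.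
by rewrite (eqP (e12 i _)) // mem_iota add0n ltn_ord.
Qed.
End Zmod.

(** Atoms are compared up to conversion: equal elements often reach the goal
    through different instances of the same algebraic structure. *)
Ltac zmod_same x y :=
  match tt with
  | _ => let _ := match tt with _ => unify x y end in constr:(true)
  | _ => constr:(false)
  end.

Ltac zmod_mem env t :=
  lazymatch env with
  | nil => constr:(false)
  | cons ?x ?env' =>
    let b := zmod_same x t in
    lazymatch b with true => constr:(true) | false => zmod_mem env' t end
  end.

Ltac zmod_atoms env t :=
  lazymatch t with
  | @Algebra.add _ ?a ?b => let env := zmod_atoms env a in zmod_atoms env b
  | @Algebra.opp _ ?a => zmod_atoms env a
  | @Algebra.zero _ => env
  | _ => let b := zmod_mem env t in
         lazymatch b with true => env | false => constr:(cons t env) end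
  end.

Ltac zmod_index env t :=
  lazymatch env with
  | cons ?x ?env' =>
    let b := zmod_same x t in
    lazymatch b with
    | true => constr:(O)
    | false => let n := zmod_index env' t in constr:(S n)
    end
  end.

Ltac zmod_reify env t :=
  lazymatch t with
  | @Algebra.add _ ?a ?b =>
    let a := zmod_reify env a in
    let b := zmod_reify env b in constr:(ZAdd a b)
  | @Algebra.opp _ ?a => let a := zmod_reify env a in constr:(ZOpp a)
  | @Algebra.zero _ => constr:(ZZero)
  | _ => let n := zmod_index env t in constr:(ZVar n)
  end.

Ltac zmod :=
  lazymatch goal with
  | |- @eq ?T ?a ?b =>
    let env := zmod_atoms (@nil T) a in
    let env := zmod_atoms env b in
    let ea := zmod_reify env a in
    let eb := zmod_reify env b in
    apply: (@zeval_eq _ env ea eb); vm_compute; reflexivity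
  end.

(** To derive an equation from a linear combination [a = b] of known ones. *)
Lemma eq_by_sub (V : zmodType) (a b c d : V) : a = b -> c - d = a - b -> c = d.
Proof. by move=> ->; rewrite subrr => /eqP; rewrite subr_eq0 => /eqP. Qed.

(** * Ext^2 from a two-step projective presentation *)

Section LinearMaps.
Variable R : nzRingType.
Implicit Types U V W P : lmodType R.

Definition linear_map U V (f : U -> V) (f_lin : linear f) : {linear U -> V} :=
  HB.pack f (GRing.isLinear.Build R U V *:%R f f_lin).

Lemma linear_mapE U V (f : U -> V) (f_lin : linear f) : linear_map f_lin =1 f.
Proof. by []. Qed.

Lemma factor_through_injective U V W (i : {linear U -> V}) (f : {linear W -> V}) :
  injective i -> (forall w, exists u, f w = i u) ->
  exists g : {linear W -> U}, forall w, i (g w) = f w.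
Proof.
move=> i_inj /boolp.choice[g gE].
have g_lin : linear g.
  by move=> a u v; apply: i_inj; rewrite linearP -!gE linearP.
by exists (linear_map g_lin) => w; rewrite linear_mapE -gE.
Qed.

Lemma lift_through_exact P U V W (a : {linear U -> V}) (b : {linear V -> W})
    (f : {linear P -> V}) :
  projective P -> (forall v, b v = 0 <-> exists u, v = a u) ->
  (forall x, b (f x) = 0) -> exists h : {linear P -> U}, forall x, a (h x) = f x.
Proof.
move=> projP exab bf0.
have inj_incl : injective (ker_incl b) by move=> x y; apply: val_inj.
have toker v : b v = 0 -> exists k : Defs.ker b, v = ker_incl b k.
  by move=> /eqP bv; exists (Ker (bv : v \in ker_pred b)).
have [|a' a'E] := @factor_through_injective _ _ _ (ker_incl b) a inj_incl.
  by move=> u; apply/toker/exab; exists u.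
have [|f' f'E] := @factor_through_injective _ _ _ (ker_incl b) f inj_incl.
  by move=> x; apply: toker.
have [|h hE] := projP _ _ a' f'.
  move=> k; have /exab[u uE] : b (ker_incl b k) = 0 by case: k => v /= /eqP.
  by exists u; apply: inj_incl; rewrite a'E.
by exists h => x; rewrite -a'E hE f'E.
Qed.
End LinearMaps.

(** An exact sequence 0 -> ts_ker -> ts_P1 -> ts_P0 -> M -> 0 with projective
    middle terms; the linear maps out of [ts_ker], modulo those that extend to
    [ts_P1], form Ext^2 out of M. *)
Record two_step (R : nzRingType) (M : lmodType R) := TwoStep {
  ts_ker : lmodType R;
  ts_P1 : lmodType R;
  ts_P0 : lmodType R;
  ts_i : {linear ts_ker -> ts_P1};
  ts_d : {linear ts_P1 -> ts_P0};
  ts_e : {linear ts_P0 -> M};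
  ts_proj1 : projective ts_P1;
  ts_proj0 : projective ts_P0;
  ts_i_inj : injective ts_i;
  ts_exact1 : forall x, ts_d x = 0 <-> exists k, x = ts_i k;
  ts_exact0 : forall x, ts_e x = 0 <-> exists y, x = ts_d y;
  ts_e_surj : forall m, exists x, ts_e x = m
}.

Section Comparison.
Variables (R : nzRingType) (M : lmodType R).
Implicit Types S T : two_step M.

Lemma ts_di S k : ts_d S (ts_i S k) = 0.
Proof. by apply/ts_exact1; exists k. Qed.
Lemma ts_ed S x : ts_e S (ts_d S x) = 0.
Proof. by apply/ts_exact0; exists x. Qed.

Lemma two_step_map S T :
  exists (f0 : {linear ts_P0 S -> ts_P0 T}) (f1 : {linear ts_P1 S -> ts_P1 T})
         (f : {linear ts_ker S -> ts_ker T}),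
    [/\ forall x, ts_e T (f0 x) = ts_e S x,
        forall x, ts_d T (f1 x) = f0 (ts_d S x)
      & forall k, ts_i T (f k) = f1 (ts_i S k)].
Proof.
have [f0 f0E] := ts_proj0 (ts_e S) (ts_e_surj T).
have [|f1 f1E] := lift_through_exact (f := f0 \o ts_d S)
    (@ts_proj1 _ _ S) (@ts_exact0 _ _ T).
  by move=> x /=; rewrite f0E ts_ed.
have [|f fE] := factor_through_injective (i := ts_i T) (f := f1 \o ts_i S)
    (@ts_i_inj _ _ T).
  by move=> k /=; apply/ts_exact1; rewrite f1E /= ts_di linear0.
by exists f0, f1, f; split.
Qed.

(** A lift of the identity of M differs from the identity by a homotopy; on
    [ts_ker] only its component out of [ts_P1] is visible, so that composing with
    the lift does not change a map out of [ts_ker] modulo the extendable ones. *)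
Lemma two_step_homotopy S (f0 : {linear ts_P0 S -> ts_P0 S})
    (f1 : {linear ts_P1 S -> ts_P1 S}) (f : {linear ts_ker S -> ts_ker S}) :
  (forall x, ts_e S (f0 x) = ts_e S x) ->
  (forall x, ts_d S (f1 x) = f0 (ts_d S x)) ->
  (forall k, ts_i S (f k) = f1 (ts_i S k)) ->
  exists h : {linear ts_P1 S -> ts_ker S}, forall k, f k = k + h (ts_i S k).
Proof.
move=> f0E f1E fE.
have [|h0 h0E] := lift_through_exact
    (f := f0 - (idfun : {linear ts_P0 S -> ts_P0 S}))
    (@ts_proj0 _ _ S) (@ts_exact0 _ _ S).
  by move=> x /=; rewrite linearB /= f0E subrr.
have [|h hE] := factor_through_injective (i := ts_i S)
    (f := f1 - (idfun : {linear ts_P1 S -> ts_P1 S}) -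
            (h0 \o ts_d S : {linear ts_P1 S -> ts_P1 S})) (@ts_i_inj _ _ S).
  by move=> k /=; apply/ts_exact1; rewrite !linearB /= h0E f1E /= subrr.
exists h => k; apply: (@ts_i_inj _ _ S).
by rewrite linearD hE /= ts_di linear0 subr0 fE addrC subrK.
Qed.

Definition extends (A : lmodType R) S (f : {linear ts_ker S -> A}) : Prop :=
  exists g : {linear ts_P1 S -> A}, forall k, f k = g (ts_i S k).

(** Composition with [f] is an isomorphism between the two groups of maps
    modulo extendable maps: by the first clause it is well defined and injective, by the second
    surjective. *)
Lemma two_step_comparison (A : lmodType R) S T :
  exists f : {linear ts_ker S -> ts_ker T},
    (forall r : {linear ts_ker T -> A}, extends (r \o f) <-> extends r) /\
    (forall r : {linear ts_ker S -> A}, exists r' : {linear ts_ker T -> A},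
       extends (r - (r' \o f : {linear ts_ker S -> A}))).
Proof.
have [f0 [f1 [f [f0E f1E fE]]]] := two_step_map S T.
have [g0 [g1 [g [g0E g1E gE]]]] := two_step_map T S.
have [|||h hE] :=
  two_step_homotopy (f0 := g0 \o f0) (f1 := g1 \o f1) (f := g \o f).
- by move=> x /=; rewrite g0E f0E.
- by move=> x /=; rewrite g1E f1E.
- by move=> x /=; rewrite gE fE.
have [|||h' h'E] :=
  two_step_homotopy (f0 := f0 \o g0) (f1 := f1 \o g1) (f := f \o g).
- by move=> x /=; rewrite f0E g0E.
- by move=> x /=; rewrite f1E g1E.
- by move=> x /=; rewrite fE gE.
exists f; split=> [r|r].
  split=> -[q qE].
    exists ((q \o g1 : {linear ts_P1 T -> A}) -
      (r \o h' : {linear ts_P1 T -> A})) => k /=.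
    by rewrite -gE -qE /= -[f (g k)]/((f \o g) k) h'E linearD addrK.
  by exists (q \o f1) => k /=; rewrite qE fE.
exists (r \o g); exists (- (r \o h : {linear ts_P1 S -> A})) => k /=.
by rewrite -[g (f k)]/((g \o f) k) hE linearD opprD addrA subrr add0r.
Qed.
End Comparison.

Section StandardTwoStep.
Variables (R : nzRingType) (M : lmodType R).

Definition syzygy_incl : {linear syzygy M 2 -> std_obj M 1} :=
  ker_incl (free_cover (syzygy M 1)).

Lemma std_two_step_exact x :
  std_d M 0 x = 0 <-> exists k, x = syzygy_incl k.
Proof.
split=> [dx|[k ->]]; last first.
  case: k => v /= /eqP v0.
  by rewrite -[LHS]/(ker_incl _ (free_cover _ v)) v0 linear0.
have x0 : x \in ker_pred (free_cover (syzygy M 1)).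
  by apply/eqP; apply: val_inj; rewrite raddf0.
by exists (Ker x0).
Qed.

(** The truncation of the standard resolution. *)
Definition std_two_step : two_step M :=
  @TwoStep R M (syzygy M 2) (std_obj M 1) (std_obj M 0)
    syzygy_incl (std_d M 0) (free_cover M)
    (@malg_projective R (syzygy M 1)) (@malg_projective R (syzygy M 0))
    val_inj std_two_step_exact (@std_exact R M 0) (@free_cover_surj R M).

Variables (A : lmodType R).

(** A 2-cocycle of the standard resolution vanishes on the kernel of the free
    cover of the second syzygy, so it is a linear map out of that syzygy. *)
Lemma cocycle_of_subproof (r : {linear syzygy M 2 -> A}) :
  (r \o free_cover (syzygy M 2) : {linear std_res M 2 -> A})
    \in @cocycle_pred R M (std_res M) A 2.
Proof.
apply/asboolP => x /=; rewrite -[RHS](linear0 r); congr (r _).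
by apply/(@std_exact R M 2); exists x.
Qed.
Definition cocycle_of r : cocycle (std_res M) A 2 :=
  Cocycle (cocycle_of_subproof r).

Lemma cocycle_of_surj z : exists r, z = cocycle_of r.
Proof.
case: z => z zc; have /asboolP z0 := zc.
pose h (k : syzygy M 2) : A := z << k >>.
have zE u : z u = h (free_cover (syzygy M 2) u).
  apply/eqP; rewrite -subr_eq0 -linearB /=.
  set w := _ - _; have /(@std_exact R M 2)[y ->] : free_cover (syzygy M 2) w = 0.
    by rewrite linearB /= malg_liftU subrr.
  by rewrite z0.
have h_lin : linear h.
  move=> a u v; have [u' <-] := free_cover_surj u; have [v' <-] := free_cover_surj v.
  by rewrite -linearP -!zE linearP.
by exists (linear_map h_lin); apply/val_inj/linear_ext => u; rewrite /= zE.
Qed.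

Lemma cocycle_of_coboundary r :
  is_coboundary (val (cocycle_of r)) <-> @extends R M A std_two_step r.
Proof.
split=> [[g gE]|[g gE]]; exists g.
  move=> k; have [u uE] := free_cover_surj k.
  by rewrite -uE; exact: gE.
by move=> x; exact: gE.
Qed.

End StandardTwoStep.

(** * Permutation modules *)

Section FreeAbelian.
Variable Y : finType.
Implicit Types (u v : {ffun Y -> int}) (y : Y).

Definition point y : {ffun Y -> int} := [ffun z => (z == y)%:R].

Definition eval_at (V : zmodType) (h : Y -> V) u : V := \sum_y h y *~ u y.

Section Eval.
Variable V : zmodType.
Implicit Types h : Y -> V.

Lemma eval_at_additive h : zmod_morphism (eval_at h).
Proof.
move=> u v; rewrite /eval_at -sumrB; apply: eq_bigr => y _.
by rewrite !ffunE mulrzBr.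
Qed.
HB.instance Definition _ h :=
  GRing.isZmodMorphism.Build {ffun Y -> int} V (eval_at h) (eval_at_additive h).

Lemma eval_at_point h y : eval_at h (point y) = h y.
Proof.
rewrite /eval_at (bigD1 y) //= ffunE eqxx big1 ?addr0 // => z /negPf zy.
by rewrite ffunE zy.
Qed.

Lemma eq_eval_at h1 h2 : h1 =1 h2 -> eval_at h1 =1 eval_at h2.
Proof. by move=> h12 u; apply: eq_bigr => y _; rewrite h12. Qed.

Lemma eval_atD h1 h2 u :
  eval_at (fun y => h1 y + h2 y) u = eval_at h1 u + eval_at h2 u.
Proof. by rewrite /eval_at -big_split; apply: eq_bigr => y _; rewrite mulrzDl. Qed.

Lemma eval_atN h u : eval_at (fun y => - h y) u = - eval_at h u.
Proof. by rewrite /eval_at -sumrN; apply: eq_bigr => y _; rewrite mulNrz. Qed.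
End Eval.

Lemma eval_at_id u : eval_at point u = u.
Proof.
apply/ffunP => y; rewrite /eval_at sum_ffunE (bigD1 y) //= big1 => [|z /negPf zy].
  by rewrite ffunMzE ffunE eqxx addr0 intz.
by rewrite ffunMzE ffunE eq_sym zy mul0rz.
Qed.

Lemma raddf_eval_at (V W : zmodType) (f : {additive V -> W}) (h : Y -> V) u :
  f (eval_at h u) = eval_at (f \o h) u.
Proof. by rewrite raddf_sum; apply: eq_bigr => y _; rewrite raddfMz. Qed.

End FreeAbelian.

Section PermutationModules.
Variable S : finGroupType.

(** The group elements span the group ring over the integers. *)
Lemma equivariant_linear (U V : lmodType (group_ring S)) (f : U -> V) :
  zmod_morphism f -> (forall g u, f (gr_elt g *: u) = gr_elt g *: f u) ->
  linear f.
Proof.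
move=> fB fg a u v.
pose f' : {additive U -> V} := HB.pack f (GRing.isZmodMorphism.Build U V f fB).
rewrite -[f]/(f' : U -> V) raddfD; congr (_ + _).
have -> : a = \sum_g gr_elt g *~ a g.
  apply/ffunP => g; rewrite sum_ffunE (bigD1 g) //= big1 => [|h /negPf hg].
    by rewrite ffunMzE ffunE eqxx addr0 intz.
  by rewrite ffunMzE ffunE eq_sym hg mul0rz.
rewrite !scaler_suml raddf_sum; apply: eq_bigr => g _.
by rewrite -!scalerMzl raddfMz /= fg.
Qed.

Section OneSet.
Variables (Y : finType) (act : gset S Y).
Local Notation ZY := (gmod (perm_gmodule act)).

Lemma gs_actK g : cancel (act g) (act g^-1%g).
Proof. by move=> y; rewrite -gs_actM mulVg gs_act1. Qed.
Lemma gs_actKV g : cancel (act g^-1%g) (act g).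
Proof. by move=> y; rewrite -gs_actM mulgV gs_act1. Qed.

Lemma gr_elt_point g y : gr_elt g *: (point y : ZY) = point (act g y).
Proof.
rewrite gr_elt_scale; apply/ffunP => z; rewrite !ffunE.
by rewrite (can2_eq (gs_actKV g) (gs_actK g)).
Qed.

Lemma eval_at_act (V : zmodType) (h : Y -> V) g (u : ZY) :
  eval_at h (gr_elt g *: u) = eval_at (h \o act g) u.
Proof.
rewrite gr_elt_scale /eval_at (reindex_inj (can_inj (gs_actK g))).
by apply: eq_bigr => y _; rewrite ffunE gs_actK.
Qed.

Section Extension.
Variables (V : lmodType (group_ring S)) (h : Y -> V).
Hypothesis h_equiv : forall g y, h (act g y) = gr_elt g *: h y.

Lemma eval_at_linear : linear (eval_at h : ZY -> V).
Proof.
apply: equivariant_linear => [|g u]; first exact: eval_at_additive.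
rewrite eval_at_act (raddf_eval_at ( *:%R (gr_elt g))).
by apply: eq_eval_at => y /=; rewrite h_equiv.
Qed.
Definition perm_lift : {linear ZY -> V} := linear_map eval_at_linear.

Lemma perm_liftE u : perm_lift u = eval_at h u. Proof. by []. Qed.
End Extension.

Lemma perm_linearE (V : lmodType (group_ring S)) (f : {linear ZY -> V}) u :
  f u = eval_at (fun y => f (point y)) u.
Proof. by rewrite -[u in LHS]eval_at_id; apply: raddf_eval_at. Qed.

(** An equivariant map from Y to S is what makes Y a free S-set: every point is
    moved by its inverse into the fibre over 1, and the values of a lift can be
    chosen arbitrarily on that fibre. *)
Lemma perm_projective (rho : Y -> S) :
  (forall g y, rho (act g y) = (g * rho y)%g) -> projective ZY.
Proof.
move=> rhoM U V g f g_surj.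
have [s sE] := boolp.choice (fun y => g_surj (f (point y))).
pose h y := gr_elt (rho y) *: s (act (rho y)^-1%g y).
have h_equiv a y : h (act a y) = gr_elt a *: h y.
  by rewrite /h rhoM invMg -gs_actM mulgKV gr_eltM scalerA.
exists (perm_lift h_equiv) => u; rewrite perm_liftE [RHS]perm_linearE raddf_eval_at.
apply: eq_eval_at => y /=; rewrite linearZ /= sE -linearZ /= gr_elt_point.
by rewrite gs_actKV.
Qed.
End OneSet.

Section Product.
Variables (X Y : finType) (a : gset S X) (b : gset S Y).

Definition prod_act (g : S) (z : X * Y) : X * Y := (a g z.1, b g z.2).
Lemma prod_act1 z : prod_act 1%g z = z.
Proof. by case: z => x y; rewrite /prod_act !gs_act1. Qed.
Lemma prod_actM g h z : prod_act (g * h)%g z = prod_act g (prod_act h z).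
Proof. by rewrite /prod_act !gs_actM. Qed.
Definition prod_gset : gset S (X * Y)%type := GSet prod_act1 prod_actM.
End Product.
End PermutationModules.

(** * A two-step resolution of Lambda *)

Section Geometry.
Variables (G F : finGroupType) (mp : matched_pair G F).
Local Notation "s ▷ x" := (mp_l mp s x) (at level 35).
Local Notation "s ◁ x" := (mp_r mp s x) (at level 35).
Local Notation Sigma := (bowtie mp).

Definition actF (p : Sigma) (x : F) : F := (p.1 * (p.2 ▷ x))%g.
Definition actG (p : Sigma) (s : G) : G := ((s ◁ (p^-1)%g.1) * (p^-1)%g.2)%g.

Lemma actF1 x : actF 1%g x = x.
Proof. by case: (X_act1 mp (inl x)). Qed.
Lemma actFM p q x : actF (p * q)%g x = actF p (actF q x).
Proof. by case: (X_actM p q (inl x)). Qed.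
Lemma actG1 s : actG 1%g s = s.
Proof. by case: (X_act1 mp (inr s)). Qed.
Lemma actGM p q s : actG (p * q)%g s = actG p (actG q s).
Proof. by case: (X_actM p q (inr s)). Qed.

Definition F_gset : gset Sigma F := GSet actF1 actFM.
Definition G_gset : gset Sigma G := GSet actG1 actGM.

Definition inF (x : F) : Sigma := (x, 1%g).
Definition inG (s : G) : Sigma := (1%g, s).

Lemma inFV x : (inF x)^-1%g = inF x^-1%g.
Proof.
apply/eqP; rewrite eq_invg_mul; apply/eqP.
by congr (_, _); rewrite /= ?mp_l1 ?mulgV // mp_r_one mulg1.
Qed.
Lemma inGV s : (inG s)^-1%g = inG s^-1%g.
Proof.
apply/eqP; rewrite eq_invg_mul; apply/eqP.
by congr (_, _); rewrite /= ?mp_l_one ?mulg1 // mp_r1 mulgV.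
Qed.

Lemma actF_inF x y : actF (inF x) y = (x * y)%g.
Proof. by rewrite /actF /= mp_l1. Qed.
Lemma actF_inG s y : actF (inG s) y = s ▷ y.
Proof. by rewrite /actF /= mul1g. Qed.
Lemma actG_inF x s : actG (inF x) s = s ◁ x^-1%g.
Proof. by rewrite /actG inFV /= mulg1. Qed.
Lemma actG_inG t s : actG (inG t) s = (s * t^-1)%g.
Proof. by rewrite /actG inGV /= mp_r1. Qed.

(** The element of Sigma that moves (x, s) to the base point (1, 1) of F x G. *)
Definition frame (x : F) (s : G) : Sigma := (inG (s ◁ x) * inF x^-1)%g.

Lemma frame_actF x s : actF (frame x s) x = 1%g.
Proof. by rewrite actFM actF_inF actF_inG mulVg mp_l_one. Qed.
Lemma frame_actG x s : actG (frame x s) s = 1%g.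
Proof. by rewrite actGM actG_inF actG_inG invgK mulgV. Qed.
(** Together with [frame_actF] and [frame_actG], this makes the action on F x G
    simply transitive. *)
Lemma frame_stab p : actF p 1%g = 1%g -> actG p 1%g = 1%g -> p = 1%g.
Proof.
case: p => x s; rewrite /actF /= mp_l_one mulg1 => ->.
by rewrite -[(1%g, s)]/(inG s) actG_inG mul1g => /eqP; rewrite invg_eq1 => /eqP ->.
Qed.
Lemma frame_act p x s : (frame (actF p x) (actG p s) * p)%g = frame x s.
Proof.
apply/eqP; rewrite eq_mulgV1; apply/eqP; apply: frame_stab.
  by rewrite -{1}(frame_actF x s) -actFM mulgKV actFM frame_actF.
by rewrite -{1}(frame_actG x s) -actGM mulgKV actGM frame_actG.
Qed.
Lemma frame11 : frame 1%g 1%g = 1%g.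
Proof. by apply: frame_stab; rewrite ?frame_actF ?frame_actG. Qed.

Definition P0_gset := prod_gset F_gset G_gset.
Definition P1_gset := prod_gset (prod_gset F_gset F_gset) (prod_gset G_gset G_gset).
Definition P0 : lmodType (group_ring Sigma) := gmod (perm_gmodule P0_gset).
Definition P1 : lmodType (group_ring Sigma) := gmod (perm_gmodule P1_gset).

(** Both modules are free because the equivariant map [frame]^-1 is defined on
    F x G, hence on any Sigma-set over it. *)
Lemma P0_projective : projective P0.
Proof.
apply: (perm_projective (rho := fun z => (frame z.1 z.2)^-1%g)) => g [x s] /=.
by rewrite -(frame_act g x s) [in RHS]invMg mulVKg.
Qed.
Lemma P1_projective : projective P1.
Proof.
apply: (perm_projective (rho := fun z => (frame z.1.1 z.2.1)^-1%g)) => g [[x y] [s t]] /=.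
by rewrite -(frame_act g x s) [in RHS]invMg mulVKg.
Qed.

(** The product of the boundary [x0, x1] |-> x1 - x0 and of its analogue on G,
    in dual form. *)
Definition mixed_diff (V : zmodType) (w : F * G -> V) (z : (F * F) * (G * G)) : V :=
  w (z.1.2, z.2.2) - w (z.1.1, z.2.2) - w (z.1.2, z.2.1) + w (z.1.1, z.2.1).

Lemma raddf_mixed_diff (V W : zmodType) (f : {additive V -> W}) w z :
  f (mixed_diff w z) = mixed_diff (f \o w) z.
Proof. by rewrite /mixed_diff raddfD !raddfB. Qed.

Definition bd (z : (F * F) * (G * G)) : P0 := mixed_diff (@point (F * G)%type) z.

Lemma bd_equiv p z : bd (P1_gset p z) = gr_elt p *: bd z.
Proof.
rewrite /bd (raddf_mixed_diff ( *:%R (gr_elt p))).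
by rewrite /mixed_diff /= !(@gr_elt_point _ _ P0_gset).
Qed.
Definition bd_map : {linear P1 -> P0} := perm_lift bd_equiv.
Lemma bd_map_point z : bd_map (point z) = bd z.
Proof. exact: eval_at_point. Qed.

Lemma eval_at_bd (V : zmodType) (w : F * G -> V) z :
  eval_at w (bd z) = mixed_diff w z.
Proof. by rewrite /bd raddf_mixed_diff /mixed_diff /= !eval_at_point. Qed.

Lemma eval_at_bd_map (V : zmodType) (w : F * G -> V) u :
  eval_at w (bd_map u) = eval_at (mixed_diff w) u.
Proof. by rewrite raddf_eval_at; apply: eq_eval_at => z; exact: eval_at_bd. Qed.

Local Notation X_gset := (bowtie_gset mp).
Local Notation ZX := (gmod (perm_gmodule X_gset)).
Definition edge (z : F * G) : ZX := point (inl z.1) - point (inr z.2).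

Lemma augmentation_point z : augmentation (point z : ZX) = 1.
Proof.
rewrite /augmentation (bigD1 z) //= ffunE eqxx big1 ?addr0 // => y /negPf yz.
by rewrite ffunE yz.
Qed.

Lemma edge_augmentation z : edge z \in ker_pred (augmentation (act := X_gset)).
Proof. by apply/eqP; rewrite linearB /= !augmentation_point subrr. Qed.
Definition Lambda_edge z : Lambda X_gset := Ker (edge_augmentation z).

Lemma Lambda_edge_equiv p z : Lambda_edge (P0_gset p z) = gr_elt p *: Lambda_edge z.
Proof.
apply: val_inj; rewrite linearZ /= /edge scalerBr !(@gr_elt_point _ _ X_gset).
by [].
Qed.
Definition edge_map : {linear P0 -> Lambda X_gset} := perm_lift Lambda_edge_equiv.

Lemma val_edge_map u : val (edge_map u) = eval_at edge u.
Proof. by rewrite /edge_map perm_liftE (raddf_eval_at val). Qed.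

(** The product of the cones over F and G with apex 1; it contracts the
    simplicial complexes that [bd] comes from. *)
Definition cone (z : F * G) : (F * F) * (G * G) := ((1%g, z.1), (1%g, z.2)).

(** An additive map on Z[X] that corrects the failure of [cone] to be a section of
    [bd] ([bd_cone]), and is a section of [edge] modulo the base point of G
    ([edge_spread]). *)
Definition spread (z : F + G) : P0 :=
  match z with
  | inl x => point (x, 1%g)
  | inr s => point (1%g, 1%g) - point (1%g, s)
  end.

Lemma bd_cone z : bd (cone z) = point z - eval_at spread (edge z).
Proof.
case: z => x s; rewrite /edge raddfB /= !eval_at_point /bd /mixed_diff /=; zmod.
Qed.

Lemma edge_spread z : eval_at edge (spread z) = point z - point (inr 1%g).
Proof.
case: z => [x|s] /=; rewrite ?raddfB /= !eval_at_point /edge //=; zmod.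
Qed.

(** If the image of m in Lambda vanishes, then so does the correction term in
    [bd_cone], and m is the boundary of its cone. *)
Lemma bd_map_exact m : edge_map m = 0 <-> exists u, m = bd_map u.
Proof.
split=> [m0|[u ->]]; last first.
  apply: val_inj; rewrite val_edge_map eval_at_bd_map raddf0.
  rewrite /eval_at big1 // => z _.
  have -> : mixed_diff edge z = 0 by rewrite /mixed_diff /edge /=; zmod.
  exact: mul0rz.
exists (eval_at (fun z => point (cone z)) m).
have edge0 : eval_at edge m = 0 by rewrite -val_edge_map m0 raddf0.
rewrite raddf_eval_at -[LHS]eval_at_id.
transitivity (eval_at (fun z => (bd (cone z) + eval_at spread (edge z)) : P0) m).
  by apply: eq_eval_at => z; rewrite bd_cone subrK.
rewrite eval_atD -(raddf_eval_at (eval_at spread)) edge0 raddf0 addr0.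
by apply: eq_eval_at => z; rewrite -bd_map_point.
Qed.

Lemma edge_map_surj l : exists m, edge_map m = l.
Proof.
case: l => a aL; exists (eval_at spread a); apply: val_inj.
rewrite val_edge_map (raddf_eval_at (eval_at edge)) /=.
rewrite (eq_eval_at (h2 := fun z => point z + (- point (inr 1%g))%R)); last first.
  by move=> z /=; rewrite edge_spread.
rewrite eval_atD eval_at_id /eval_at -mulrz_sumr.
by rewrite [X in _ *~ X](eqP aL) mulr0z addr0.
Qed.

Lemma ker_bd_exact u : bd_map u = 0 <-> exists k, u = ker_incl bd_map k.
Proof.
split=> [u0|[[k kE] ->]]; last exact/eqP.
have uk : u \in ker_pred bd_map by apply/eqP.
by exists (Ker uk).
Qed.

Definition bowtie_two_step : two_step (Lambda X_gset) :=
  @TwoStep _ _ _ _ _ (ker_incl bd_map) bd_map edge_map P1_projective P0_projective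
    val_inj ker_bd_exact bd_map_exact edge_map_surj.
End Geometry.

(** * Linear maps on the kernel as cochains with invariant differentials *)

Section Cochains.
Variables (G F : finGroupType) (mp : matched_pair G F) (A : zmodType).
Local Notation Sigma := (bowtie mp).
Local Notation cochain := ((F * F) * (G * G) -> A).
Local Notation K := (Defs.ker (bd_map mp)).

Definition dF (V : zmodType) (w : (F * F) * (G * G) -> V) x0 x1 x2 s0 s1 : V :=
  w ((x1, x2), (s0, s1)) - w ((x0, x2), (s0, s1)) + w ((x0, x1), (s0, s1)).
Definition dG (V : zmodType) (w : (F * F) * (G * G) -> V) x0 x1 s0 s1 s2 : V :=
  w ((x0, x1), (s1, s2)) - w ((x0, x1), (s0, s2)) + w ((x0, x1), (s0, s1)).

Definition d_closed (w : cochain) : Prop :=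
  (forall x0 x1 x2 s0 s1, dF w x0 x1 x2 s0 s1 = 0) /\
  (forall x0 x1 s0 s1 s2, dG w x0 x1 s0 s1 s2 = 0).

(** A function killed by both differentials is determined by its values on cones,
    and is then pulled back along the boundary of F^2 x G^2. *)
Lemma d_closed_mixed_diff w z : d_closed w -> w z = mixed_diff (w \o @cone G F) z.
Proof.
case: z => [[x0 x1] [s0 s1]] [wF wG].
have wFE : w ((x0, x1), (s0, s1)) =
    w ((1%g, x1), (s0, s1)) - w ((1%g, x0), (s0, s1)).
  by apply/eqP; rewrite -subr_eq0 -(wF 1%g x0 x1 s0 s1) /dF; apply/eqP; zmod.
have wGE x : w ((1%g, x), (s0, s1)) =
    w ((1%g, x), (1%g, s1)) - w ((1%g, x), (1%g, s0)).
  by apply/eqP; rewrite -subr_eq0 -(wG 1%g x 1%g s0 s1) /dG; apply/eqP; zmod.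
by rewrite wFE !wGE /mixed_diff /=; zmod.
Qed.

Lemma raddf_dF (V W : zmodType) (f : {additive V -> W}) w x0 x1 x2 s0 s1 :
  f (dF w x0 x1 x2 s0 s1) = dF (f \o w) x0 x1 x2 s0 s1.
Proof. by rewrite /dF raddfD raddfB. Qed.
Lemma raddf_dG (V W : zmodType) (f : {additive V -> W}) w x0 x1 s0 s1 s2 :
  f (dG w x0 x1 s0 s1 s2) = dG (f \o w) x0 x1 s0 s1 s2.
Proof. by rewrite /dG raddfD raddfB. Qed.

(** If both differentials of w vanish then w factors through [bd_map], so it kills
    K; conversely the boundaries of F^3 x G^2 and F^2 x G^3 lie in K. *)
Lemma d_closedP w : d_closed w <-> forall k : K, eval_at w (val k) = 0.
Proof.
split=> [wc [u uK]|w0].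
  rewrite (eq_eval_at (fun z => d_closed_mixed_diff z wc)).
  rewrite -(@eval_at_bd_map _ _ mp _ (w \o @cone G F) u).
  by rewrite [bd_map mp _](eqP uK) raddf0.
have w0' (u : P1 mp) : bd_map mp u = 0 -> eval_at w u = 0.
  by move=> /eqP uK; apply: (w0 (Ker (uK : u \in ker_pred (bd_map mp)))).
split=> [x0 x1 x2 s0 s1|x0 x1 s0 s1 s2].
  have := w0' (dF (@point _) x0 x1 x2 s0 s1).
  rewrite (raddf_dF (eval_at w)) {2}/dF /= !eval_at_point; apply.
  rewrite (raddf_dF (eval_at (bd mp))) /dF /= !eval_at_point.
  by rewrite /bd /mixed_diff /=; zmod.
have := w0' (dG (@point _) x0 x1 s0 s1 s2).
rewrite (raddf_dG (eval_at w)) {2}/dG /= !eval_at_point; apply.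
rewrite (raddf_dG (eval_at (bd mp))) /dG /= !eval_at_point.
by rewrite /bd /mixed_diff /=; zmod.
Qed.

Lemma dFB (w w' : cochain) x0 x1 x2 s0 s1 :
  dF (fun z => w z - w' z) x0 x1 x2 s0 s1 =
  dF w x0 x1 x2 s0 s1 - dF w' x0 x1 x2 s0 s1.
Proof. by rewrite /dF; zmod. Qed.
Lemma dGB (w w' : cochain) x0 x1 s0 s1 s2 :
  dG (fun z => w z - w' z) x0 x1 s0 s1 s2 =
  dG w x0 x1 s0 s1 s2 - dG w' x0 x1 s0 s1 s2.
Proof. by rewrite /dG; zmod. Qed.

Lemma d_closedB w w' :
  d_closed (fun z => w z - w' z) <->
  (forall x0 x1 x2 s0 s1, dF w x0 x1 x2 s0 s1 = dF w' x0 x1 x2 s0 s1) /\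
  (forall x0 x1 s0 s1 s2, dG w x0 x1 s0 s1 s2 = dG w' x0 x1 s0 s1 s2).
Proof.
split=> -[wF wG]; split=> *; last by rewrite dGB wG subrr.
- by apply/eqP; rewrite -subr_eq0 -dFB wF.
- by apply/eqP; rewrite -subr_eq0 -dGB wG.
- by rewrite dFB wF subrr.
Qed.

Definition inv_dF (w : cochain) : Prop := forall (p : Sigma) x0 x1 x2 s0 s1,
  dF w (actF p x0) (actF p x1) (actF p x2) (actG p s0) (actG p s1) =
  dF w x0 x1 x2 s0 s1.
Definition inv_dG (w : cochain) : Prop := forall (p : Sigma) x0 x1 s0 s1 s2,
  dG w (actF p x0) (actF p x1) (actG p s0) (actG p s1) (actG p s2) =
  dG w x0 x1 s0 s1 s2.

(** Apply [d_closedP] to the difference of w and its translate by p. *)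
Lemma equivariantP w :
  inv_dF w /\ inv_dG w <->
  forall (p : Sigma) (k : K), eval_at w (val (gr_elt p *: k)) = eval_at w (val k).
Proof.
have evalB p (k : K) : eval_at (fun z => w (P1_gset mp p z) - w z) (val k) =
    eval_at w (val (gr_elt p *: k)) - eval_at w (val k).
  rewrite eval_atD eval_atN; congr (_ - _).
  by rewrite linearZ; exact/esym/eval_at_act.
split=> [[iF iG] p k|wK].
  apply/eqP; rewrite -subr_eq0 -evalB; apply/eqP; move: k; apply/d_closedP/d_closedB.
  by split=> *; [apply: iF | apply: iG].
have wc p : d_closed (fun z => w (P1_gset mp p z) - w z).
  by apply/d_closedP => k; rewrite evalB wK subrr.
have {}wc p := (d_closedB _ _).1 (wc p).
by split=> p *; [apply: (wc p).1 | apply: (wc p).2].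
Qed.

Lemma inv_diffB w w' : inv_dF w /\ inv_dG w -> inv_dF w' /\ inv_dG w' ->
  inv_dF (fun z => w z - w' z) /\ inv_dG (fun z => w z - w' z).
Proof.
move=> [wF wG] [wF' wG']; split=> p *; first by rewrite !dFB wF wF'.
by rewrite !dGB wG wG'.
Qed.

Local Notation A_triv := (trivial_module Sigma A).

Lemma restr_subproof w : inv_dF w /\ inv_dG w ->
  linear (fun k : K => eval_at w (val k) : A_triv).
Proof.
move=> /equivariantP wK.
apply: equivariant_linear => [k l|p k]; first by rewrite !raddfB.
by rewrite gr_elt_scale; exact: wK.
Qed.
Definition restr w (w_inv : inv_dF w /\ inv_dG w) : {linear K -> A_triv} :=
  linear_map (restr_subproof w_inv).

(** Subtracting from a point the cone over its boundary is an additive projection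
    of Z[F^2 x G^2] onto K; compose the given map with it. *)
Lemma restr_surj (r : {linear K -> A_triv}) :
  exists w (w_inv : inv_dF w /\ inv_dG w), forall k, r k = restr w_inv k.
Proof.
pose e z : P1 mp := point z - mixed_diff (fun y => point (cone y)) z.
have eK z : e z \in ker_pred (bd_map mp).
  apply/eqP; rewrite -[LHS]/(eval_at (bd mp) (e z)) raddfB /= raddf_mixed_diff.
  by rewrite /mixed_diff /= !eval_at_point /bd /mixed_diff /=; zmod.
have eE (k : K) : eval_at (fun z => Ker (eK z)) (val k) = k.
  apply: val_inj; rewrite (raddf_eval_at val) eval_atD eval_at_id eval_atN.
  rewrite -(@eval_at_bd_map _ _ mp).
  by rewrite [bd_map mp _](eqP (valP k)) raddf0 subr0.
pose w z : A := r (Ker (eK z)).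
have wE (k : K) : eval_at w (val k) = r k by rewrite -[in RHS](eE k) raddf_eval_at.
have w_inv : inv_dF w /\ inv_dG w.
  by apply/equivariantP => p k; rewrite !wE linearZ /= gr_elt_scale.
by exists w, w_inv => k; rewrite -wE.
Qed.

Lemma extends_restrP w (w_inv : inv_dF w /\ inv_dG w) :
  @extends _ _ A_triv (bowtie_two_step mp) (restr w_inv) <->
  exists v, (forall p z, v (P1_gset mp p z) = v z) /\ d_closed (fun z => w z - v z).
Proof.
split=> [[g gE]|[v [v_inv /d_closedP wv]]].
  exists (fun z => g (point z)); split=> [p z|].
    by rewrite -(@gr_elt_point _ _ (P1_gset mp)) linearZ /= gr_elt_scale.
  apply/d_closedP => k; rewrite eval_atD eval_atN; apply/eqP; rewrite subr_eq0.
  by apply/eqP; rewrite -[RHS](perm_linearE g); exact: gE.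
have v_equiv p z : v (P1_gset mp p z) = gr_elt p *: (v z : A_triv).
  by rewrite gr_elt_scale v_inv.
exists (@perm_lift _ _ (P1_gset mp) A_triv v v_equiv) => k.
by apply/eqP; rewrite -subr_eq0 -(wv k) eval_atD eval_atN; apply/eqP.
Qed.
End Cochains.

(** * Invariant functions and their normal forms *)

Section Homogenisation.
Variables (G F : finGroupType) (mp : matched_pair G F) (A : zmodType).
Local Notation "s ▷ x" := (mp_l mp s x) (at level 35).
Local Notation "s ◁ x" := (mp_r mp s x) (at level 35).
Local Notation Sigma := (bowtie mp).
Local Notation cochain := ((F * F) * (G * G) -> A).
Implicit Types (S : G * F * F -> A) (T : G * G * F -> A) (v : G * F -> A).

(** Functions of (s; x), (s; x, y) and (s, t; x) become invariant functions on
    F^2 x G^2, F^3 x G^2 and F^2 x G^3 whose values at (1, x; s, 1),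
    (1, x, xy; s, 1) and (1, x; st, t, 1) are v(s; x), S(s; x, y) and - T(s, t; x).
    The sign makes the compatibility of S and T the commutation of the
    differentials dF and dG. *)
Definition homog v : cochain := fun z =>
  let p := frame mp z.1.1 z.2.2 in v (actG p z.2.1, actF p z.1.2).
Definition homogF S x0 x1 x2 s0 s1 : A :=
  let p := frame mp x0 s1 in
  S (actG p s0, actF p x1, ((actF p x1)^-1 * actF p x2)%g).
Definition homogG T x0 x1 s0 s1 s2 : A :=
  let p := frame mp x0 s2 in
  - T ((actG p s0 * (actG p s1)^-1)%g, actG p s1, actF p x1).

Lemma P1_gsetE (p : Sigma) x0 x1 s0 s1 :
  P1_gset mp p ((x0, x1), (s0, s1)) =
  ((actF p x0, actF p x1), (actG p s0, actG p s1)).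
Proof. by []. Qed.

Lemma homog_inv v (p : Sigma) z : homog v (P1_gset mp p z) = homog v z.
Proof. by case: z => -[x0 x1] [s0 s1]; rewrite /homog /= -actGM -actFM frame_act. Qed.
Lemma homogF_inv S (p : Sigma) x0 x1 x2 s0 s1 :
  homogF S (actF p x0) (actF p x1) (actF p x2) (actG p s0) (actG p s1) =
  homogF S x0 x1 x2 s0 s1.
Proof. by rewrite /homogF -!actGM -!actFM frame_act. Qed.
Lemma homogG_inv T (p : Sigma) x0 x1 s0 s1 s2 :
  homogG T (actF p x0) (actF p x1) (actG p s0) (actG p s1) (actG p s2) =
  homogG T x0 x1 s0 s1 s2.
Proof. by rewrite /homogG -!actGM -!actFM frame_act. Qed.

Lemma homog_std v s x : homog v ((1%g, x), (s, 1%g)) = v (s, x).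
Proof. by rewrite /homog frame11 actG1 actF1. Qed.
Lemma homogF_std S s x y : homogF S 1%g x (x * y)%g s 1%g = S (s, x, y).
Proof. by rewrite /homogF frame11 actG1 !actF1 mulKg. Qed.
Lemma homogG_std T s t x : homogG T 1%g x (s * t)%g t 1%g = - T (s, t, x).
Proof. by rewrite /homogG frame11 !actG1 actF1 mulgK. Qed.

(** At a point whose first vertex in F, or last vertex in G, is not 1, the matched
    pair actions appear: translating it back by an element of F or of G moves the
    other coordinates.  This is where the twisted arguments of the cocycle
    identities come from. *)
Lemma homog_shiftF v s x y : homog v ((x, (x * y)%g), (s, 1%g)) = v (s ◁ x, y).
Proof.
rewrite -(homog_inv v (inF mp x^-1)) P1_gsetE !actF_inF !actG_inF invgK.
by rewrite mulVg mulKg mp_r_one homog_std.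
Qed.
Lemma homog_shiftG v s t x : homog v ((1%g, x), ((s * t)%g, t)) = v (s, t ▷ x).
Proof.
rewrite -(homog_inv v (inG mp t)) P1_gsetE !actF_inG !actG_inG.
by rewrite mulgV mulgK mp_l_one homog_std.
Qed.

Lemma homogF_shiftF S s x y z :
  homogF S x (x * y)%g (x * y * z)%g s 1%g = S (s ◁ x, y, z).
Proof.
rewrite -(homogF_inv S (inF mp x^-1)) !actF_inF !actG_inF invgK.
by rewrite mulVg -mulgA !mulKg mp_r_one homogF_std.
Qed.
Lemma homogF_shiftG S s t x y :
  homogF S 1%g x (x * y)%g (s * t)%g t = S (s, t ▷ x, (t ◁ x) ▷ y).
Proof.
rewrite -(homogF_inv S (inG mp t)) !actF_inG !actG_inG.
by rewrite mulgV mulgK mp_l_one mp_l_mul homogF_std.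
Qed.
Lemma homogG_shiftF T s t x y :
  homogG T x (x * y)%g (s * t)%g t 1%g = - T (s ◁ (t ▷ x), t ◁ x, y).
Proof.
rewrite -(homogG_inv T (inF mp x^-1)) !actF_inF !actG_inF invgK.
by rewrite mulVg mulKg mp_r_one mp_r_mul homogG_std.
Qed.
Lemma homogG_shiftG T s t r x :
  homogG T 1%g x (s * t * r)%g (t * r)%g r = - T (s, t, r ▷ x).
Proof.
rewrite -(homogG_inv T (inG mp r)) !actF_inG !actG_inG.
by rewrite mulgV !mulgK mp_l_one homogG_std.
Qed.

(** The normal forms of the differentials of a cochain, with the sign of [homogG]. *)
Definition dehomogF (w : cochain) (a : G * F * F) : A :=
  dF w 1%g a.1.2 (a.1.2 * a.2)%g a.1.1 1%g.
Definition dehomogG (w : cochain) (a : G * G * F) : A :=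
  - dG w 1%g a.2 (a.1.1 * a.1.2)%g a.1.2 1%g.

Lemma dF_homogF w x0 x1 x2 s0 s1 : inv_dF mp w ->
  dF w x0 x1 x2 s0 s1 = homogF (dehomogF w) x0 x1 x2 s0 s1.
Proof.
move=> w_inv; rewrite /homogF /dehomogF /= mulKVg -(w_inv (frame mp x0 s1)).
by rewrite frame_actF frame_actG.
Qed.
Lemma dG_homogG w x0 x1 s0 s1 s2 : inv_dG mp w ->
  dG w x0 x1 s0 s1 s2 = homogG (dehomogG w) x0 x1 s0 s1 s2.
Proof.
move=> w_inv; rewrite /homogG /dehomogG /= mulgKV opprK -(w_inv (frame mp x0 s2)).
by rewrite frame_actF frame_actG.
Qed.

(** The conditions on (sigma, tau) written additively, without normalization. *)
Record is_cocycle (S : G * F * F -> A) (T : G * G * F -> A) : Prop := IsCocycle {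
  cocycleF : forall s x y z,
    S (s ◁ x, y, z) + S (s, x, (y * z)%g) = S (s, x, y) + S (s, (x * y)%g, z);
  cocycleG : forall s t r x,
    T ((s * t)%g, r, x) + T (s, t, r ▷ x) = T (s, (t * r)%g, x) + T (t, r, x);
  cocycleFG : forall s t x y,
    S ((s * t)%g, x, y) + T (s, t, (x * y)%g) =
    S (s, t ▷ x, (t ◁ x) ▷ y) + S (t, x, y) + T (s, t, x) +
      T (s ◁ (t ▷ x), t ◁ x, y)
}.

Section Cocycle.
Variables (S : G * F * F -> A) (T : G * G * F -> A).
Hypothesis ST : is_cocycle S T.

(** By invariance it suffices to check the simplicial identities at the normal
    forms, where they are the cocycle conditions term by term. *)
Lemma homogF_cocycle x0 x1 x2 x3 s0 s1 :
  homogF S x1 x2 x3 s0 s1 - homogF S x0 x2 x3 s0 s1 + homogF S x0 x1 x3 s0 s1 =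
  homogF S x0 x1 x2 s0 s1.
Proof.
set p := frame mp x0 s1.
rewrite -(homogF_inv S p x1 x2) -(homogF_inv S p x0 x2) -(homogF_inv S p x0 x1 x3).
rewrite -(homogF_inv S p x0 x1 x2) frame_actF frame_actG.
move: (actF p x1) (actF p x2) (actF p x3) (actG p s0) =>
  {x0 s1 p x1 x2 x3 s0} x x2 x3 s.
rewrite -(mulKVg x x2); move: (x^-1 * x2)%g => y.
rewrite -(mulKVg (x * y)%g x3); move: ((x * y)^-1 * x3)%g => z.
rewrite homogF_shiftF !homogF_std -(mulgA x y z) homogF_std.
apply: (eq_by_sub (cocycleF ST s x y z)); zmod.
Qed.

Lemma homogG_cocycle x0 x1 s0 s1 s2 s3 :
  homogG T x0 x1 s1 s2 s3 - homogG T x0 x1 s0 s2 s3 + homogG T x0 x1 s0 s1 s3 =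
  homogG T x0 x1 s0 s1 s2.
Proof.
set p := frame mp x0 s3.
rewrite -(homogG_inv T p x0 x1 s1 s2) -(homogG_inv T p x0 x1 s0 s2).
rewrite -(homogG_inv T p x0 x1 s0 s1 s3) -(homogG_inv T p x0 x1 s0 s1 s2).
rewrite frame_actF frame_actG.
move: (actF p x1) (actG p s0) (actG p s1) (actG p s2) =>
  {x0 x1 p s0 s1 s2 s3} x s0 s1 r.
rewrite -(mulgKV r s1); move: (s1 * r^-1)%g => t.
rewrite -(mulgKV (t * r)%g s0); move: (s0 * (t * r)^-1)%g => s.
rewrite homogG_std homogG_std mulgA homogG_std homogG_shiftG.
apply: (eq_by_sub (cocycleG ST s t r x)); zmod.
Qed.

Lemma homogFG_cocycle x0 x1 x2 s0 s1 s2 :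
  homogF S x0 x1 x2 s1 s2 - homogF S x0 x1 x2 s0 s2 + homogF S x0 x1 x2 s0 s1 =
  homogG T x1 x2 s0 s1 s2 - homogG T x0 x2 s0 s1 s2 + homogG T x0 x1 s0 s1 s2.
Proof.
set p := frame mp x0 s2.
rewrite -(homogF_inv S p x0 x1 x2 s1 s2) -(homogF_inv S p x0 x1 x2 s0 s2).
rewrite -(homogF_inv S p x0 x1 x2 s0 s1) -(homogG_inv T p x1 x2).
rewrite -(homogG_inv T p x0 x2) -(homogG_inv T p x0 x1) frame_actF frame_actG.
move: (actF p x1) (actF p x2) (actG p s0) (actG p s1) =>
  {x0 x1 x2 p s0 s1 s2} x x2 s0 t.
rewrite -(mulKVg x x2); move: (x^-1 * x2)%g => y.
rewrite -(mulgKV t s0); move: (s0 * t^-1)%g => s.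
rewrite !homogF_std homogF_shiftG !homogG_std homogG_shiftF.
apply: (eq_by_sub (esym (cocycleFG ST s t x y))); zmod.
Qed.
End Cocycle.
End Homogenisation.

(** * Cocycle pairs are the differentials of explicit cochains *)

Section Primitive.
Variables (G F : finGroupType) (mp : matched_pair G F) (A : zmodType).
Local Notation "s ▷ x" := (mp_l mp s x) (at level 35).
Local Notation "s ◁ x" := (mp_r mp s x) (at level 35).
Implicit Types (S : G * F * F -> A) (T : G * G * F -> A) (v : G * F -> A).
Local Notation cochain := ((F * F) * (G * G) -> A).

(** Coning S in the F-direction gives a cochain with differential S along F; its
    differential along G misses T by the F-coboundary of T coned once, and the last
    two terms, the F-coboundary of T coned in both directions, repair this without
    changing the differential along F. *)
Definition primitive S T : cochain := fun z =>
  homogF mp S 1%g z.1.1 z.1.2 z.2.1 z.2.2 + homogG mp T 1%g z.1.2 1%g z.2.1 z.2.2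
  - homogG mp T 1%g z.1.1 1%g z.2.1 z.2.2.

Lemma dF_primitive S T : is_cocycle mp S T ->
  forall x0 x1 x2 s0 s1,
    dF (primitive S T) x0 x1 x2 s0 s1 = homogF mp S x0 x1 x2 s0 s1.
Proof.
move=> ST x0 x1 x2 s0 s1; rewrite /dF /primitive /=.
by apply: (eq_by_sub (esym (homogF_cocycle ST 1%g x0 x1 x2 s0 s1))); zmod.
Qed.

Lemma dG_primitive S T : is_cocycle mp S T ->
  forall x0 x1 s0 s1 s2,
    dG (primitive S T) x0 x1 s0 s1 s2 = homogG mp T x0 x1 s0 s1 s2.
Proof.
move=> ST x0 x1 s0 s1 s2; rewrite /dG /primitive /=.
(* The mixed identity at (1, x0, x1; s0, s1, s2), and the identity for T along the
   edges from 1 to x0 and from 1 to x1. *)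
have eFG := homogFG_cocycle ST 1%g x0 x1 s0 s1 s2.
have e0 := homogG_cocycle ST 1%g x0 1%g s0 s1 s2.
have e1 := homogG_cocycle ST 1%g x1 1%g s0 s1 s2.
by apply: (eq_by_sub (congr2 +%R (congr2 +%R eFG e0) (esym e1))); zmod.
Qed.

Lemma primitive_inv S T : is_cocycle mp S T ->
  inv_dF mp (primitive S T) /\ inv_dG mp (primitive S T).
Proof.
move=> ST; split=> p *; first by rewrite !dF_primitive // homogF_inv.
by rewrite !dG_primitive // homogG_inv.
Qed.

Lemma homog_inv_diff v : inv_dF mp (homog mp v) /\ inv_dG mp (homog mp v).
Proof.
by split=> p *; rewrite /dF /dG -!(@P1_gsetE _ _ mp) !homog_inv.
Qed.

Lemma dehomogF_homog v s x y :
  dehomogF (homog mp v) (s, x, y) = v (s, x) + v (s ◁ x, y) - v (s, (x * y)%g).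
Proof. by rewrite /dehomogF /dF /= homog_shiftF !homog_std; zmod. Qed.
Lemma dehomogG_homog v s t x :
  dehomogG (homog mp v) (s, t, x) = v ((s * t)%g, x) - v (s, t ▷ x) - v (t, x).
Proof. by rewrite /dehomogG /dG /= homog_shiftG !homog_std; zmod. Qed.

(** The simplicial identities for dF w and dG w, read at the normal forms. *)
Lemma dehomog_cocycle (w : cochain) : inv_dF mp w -> inv_dG mp w ->
  is_cocycle mp (dehomogF w) (dehomogG w).
Proof.
move=> wF wG; split=> [s x y z|s t r x|s t x y].
- rewrite -[dehomogF w (s ◁ x, y, z)](homogF_shiftF mp).
  rewrite -!(homogF_std mp (dehomogF w)) -!dF_homogF //.
  by rewrite !mulgA /dF; zmod.
- have GE s' t' x' : dehomogG w (s', t', x') = - dG w 1%g x' (s' * t')%g t' 1%g by [].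
  have -> : dehomogG w (s, t, r ▷ x) = - dG w 1%g x (s * t * r)%g (t * r)%g r.
    by rewrite (dG_homogG _ _ _ _ _ wG) homogG_shiftG opprK.
  by rewrite !GE !mulgA /dG; zmod.
have GE s' t' x' : dehomogG w (s', t', x') = - dG w 1%g x' (s' * t')%g t' 1%g by [].
have -> : dehomogG w (s ◁ (t ▷ x), t ◁ x, y) = - dG w x (x * y)%g (s * t)%g t 1%g.
  by rewrite (dG_homogG _ _ _ _ _ wG) homogG_shiftF opprK.
rewrite -[dehomogF w (s, _, _)](homogF_shiftG mp).
rewrite -!(homogF_std mp (dehomogF w)) -!dF_homogF //.
by rewrite !GE /dF /dG; zmod.
Qed.

Lemma is_cocycleB S T S' T' : is_cocycle mp S T -> is_cocycle mp S' T' ->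
  is_cocycle mp (fun a => S a - S' a) (fun a => T a - T' a).
Proof.
move=> [c1 c2 c3] [c1' c2' c3']; split=> [s x y z|s t r x|s t x y].
- by apply: (eq_by_sub (congr2 (fun a b => a - b) (c1 s x y z) (c1' s x y z))); zmod.
- by apply: (eq_by_sub (congr2 (fun a b => a - b) (c2 s t r x) (c2' s t r x))); zmod.
- by apply: (eq_by_sub (congr2 (fun a b => a - b) (c3 s t x y) (c3' s t x y))); zmod.
Qed.

Definition normalized S T : Prop :=
  (forall s x y, x = 1%g \/ y = 1%g -> S (s, x, y) = 0) /\
  (forall s t x, s = 1%g \/ t = 1%g -> T (s, t, x) = 0).

(** The cocycle conditions reduce normalization to the vanishing of S(s; 1, 1) and
    of T(1, 1; x).  These values change by v(s; 1) and - v(1; x), and the two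
    requirements on v(1; 1) agree since compatibility at the identity gives
    S(1; 1, 1) = - T(1, 1; 1). *)
Lemma normalize S T : is_cocycle mp S T -> exists v,
  normalized (fun a => S a - dehomogF (homog mp v) a)
             (fun a => T a - dehomogG (homog mp v) a).
Proof.
case=> c1 c2 c3.
(* The constant makes v equal to S(s; 1, 1) at x = 1 and to - T(1, 1; x) at s = 1. *)
exists (fun a => S (a.1, 1%g, 1%g) - T (1%g, 1%g, a.2) + T (1%g, 1%g, 1%g)).
have e11 : S (1%g, 1%g, 1%g) = - T (1%g, 1%g, 1%g).
  have := c3 1%g 1%g 1%g 1%g; rewrite !(mulg1, mp_r1, mp_l1) => e.
  by apply: (eq_by_sub (esym e)); zmod.
split=> [s x y [->|->]|s t x [->|->]].
- have := c1 s 1%g 1%g y; rewrite mp_r1 !mul1g => e.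
  rewrite dehomogF_homog /= mp_r1 !mul1g.
  by apply: (eq_by_sub e); zmod.
- have := c1 s x 1%g 1%g; rewrite !mulg1 => e.
  rewrite dehomogF_homog /= mulg1.
  by apply: (eq_by_sub (esym e)); zmod.
- have := c2 1%g 1%g t x; rewrite !mul1g => e.
  rewrite dehomogG_homog /= mul1g e11.
  by apply: (eq_by_sub (esym e)); zmod.
- have := c2 s 1%g 1%g x; rewrite !mulg1 mp_l1 => e.
  rewrite dehomogG_homog /= mulg1 mp_l1 e11.
  by apply: (eq_by_sub e); zmod.
Qed.

Lemma normalized_gauge v :
  normalized (dehomogF (homog mp v)) (dehomogG (homog mp v)) ->
  (forall s, v (s, 1%g) = 0) /\ (forall x, v (1%g, x) = 0).
Proof.
move=> [nF nG]; split=> [s|x].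
  have := nF s 1%g 1%g (or_introl erefl).
  by rewrite dehomogF_homog mp_r1 mul1g addrK.
have := nG 1%g 1%g x (or_introl erefl).
by rewrite dehomogG_homog mp_l1 mul1g subrr sub0r => /eqP; rewrite oppr_eq0 => /eqP.
Qed.
End Primitive.

(** * The isomorphism *)

Section Assembly.
Variables (k : fieldType) (G F : finGroupType) (mp : matched_pair G F).
Local Notation Sigma := (bowtie mp).
Local Notation A := (trivial_module Sigma (kstar k)).
Local Notation K := (Defs.ker (bd_map mp)).
Implicit Types (p q : datum k mp).

Lemma datum_predP (c : cochain_pair k G F) :
  c \in datum_pred mp <-> normalized c.1 c.2 /\ is_cocycle mp c.1 c.2.
Proof.
split=> [/asboolP[nS nT cS cT cST]|[[nS nT] [cS cT cST]]]; last first.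
  apply/asboolP; split=> *.
  - exact: (congr1 (@kval k) (nS _ _ _ _)).
  - exact: (congr1 (@kval k) (nT _ _ _ _)).
  - exact: (congr1 (@kval k) (cS _ _ _ _)).
  - exact: (congr1 (@kval k) (cT _ _ _ _)).
  - exact: (congr1 (@kval k) (cST _ _ _ _)).
split; split=> *; apply: kval_inj; rewrite ?kvalD.
- exact: nS.
- exact: nT.
- exact: cS.
- exact: cT.
- exact: cST.
Qed.

Lemma datum_normalized p : normalized (val p).1 (val p).2.
Proof. by have [] := (datum_predP _).1 (valP p). Qed.
Lemma datum_cocycle p : is_cocycle mp (val p).1 (val p).2.
Proof. by have [] := (datum_predP _).1 (valP p). Qed.

Lemma gauge_dE (v : gauge k G F) :
  (gauge_d mp v).1 =1 dehomogF (homog mp v) /\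
  (gauge_d mp v).2 =1 dehomogG (homog mp v).
Proof.
by split=> -[[a b] c]; rewrite ffunE ?dehomogF_homog ?dehomogG_homog.
Qed.

(** The linear map on K attached to a pair (sigma, tau). *)
Definition datum_map p : {linear K -> A} := restr (primitive_inv (datum_cocycle p)).

Lemma datum_mapB p q : datum_map (p - q) = datum_map p - datum_map q.
Proof.
apply: linear_ext => u.
rewrite -[LHS]/(eval_at _ (val u)) -[RHS]/(eval_at _ (val u) - eval_at _ (val u)).
rewrite -eval_atN -eval_atD; apply: eq_eval_at => z.
by rewrite /primitive /homogF /homogG raddfB !ffunE; zmod.
Qed.

(** An extension to Z[F^2 x G^2] is an invariant cochain with the same
    differentials, that is, the homogeneous form of a function v whose coboundary
    is the given pair. *)
Lemma datum_map_extendsP p :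
  extends (S := bowtie_two_step mp) (datum_map p) <->
  exists v : gauge k G F, gauge_normal v /\ datum_val p = gauge_d mp v.
Proof.
rewrite extends_restrP; split=> [[w [w_inv /d_closedB[wF wG]]]|[v [_ pv]]].
  pose v : gauge k G F := [ffun a => w ((1%g, a.2), (a.1, 1%g))].
  have wE z : w z = homog mp v z.
    case: z => [[x0 x1] [s0 s1]]; rewrite -(w_inv (frame mp x0 s1)) P1_gsetE.
    by rewrite frame_actF frame_actG /homog ffunE.
  have pvF : (val p).1 =1 dehomogF (homog mp v).
    move=> [[s x] y]; rewrite -(homogF_std mp (val p).1).
    by rewrite -(dF_primitive (datum_cocycle p)) wF /dehomogF /dF !wE.
  have pvG : (val p).2 =1 dehomogG (homog mp v).
    move=> [[s t] x]; rewrite -[LHS]opprK -(homogG_std mp (val p).2).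
    by rewrite -(dG_primitive (datum_cocycle p)) wG /dehomogG /dG !wE.
  have pv : datum_val p = gauge_d mp v.
    have [vF vG] := gauge_dE v; rewrite [LHS]surjective_pairing [RHS]surjective_pairing.
    by congr (_, _); apply/ffunP => a; rewrite ?vF ?vG -?pvF -?pvG.
  exists v; split=> //; apply: (@normalized_gauge _ _ mp).
  have [nF nG] := datum_normalized p.
  by split=> *; rewrite -?pvF -?pvG; [apply: nF | apply: nG].
have {}pv : val p = gauge_d mp v by [].
exists (homog mp v); split; first exact: homog_inv.
have [iF iG] := homog_inv_diff mp v; have [vF vG] := gauge_dE v.
apply/d_closedB; split=> *.
  by rewrite (dF_primitive (datum_cocycle p)) (dF_homogF _ _ _ _ _ iF) /homogF pv vF.
by rewrite (dG_primitive (datum_cocycle p)) (dG_homogG _ _ _ _ _ iG) /homogG pv vG.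
Qed.

(** A linear map on K comes from a cochain w; the normal forms of dF w and dG w form
    a cocycle pair, and the function v that normalizes it contributes the invariant
    cochain [homog v], whose restriction to K is extendable. *)
Lemma datum_map_surj (r : {linear K -> A}) :
  exists p, extends (S := bowtie_two_step mp) (r - datum_map p).
Proof.
have [w [w_inv rE]] := restr_surj r; have [wF wG] := w_inv.
have wST := dehomog_cocycle wF wG.
have [v [nF nG]] := normalize wST.
have [iF iG] := homog_inv_diff mp v.
pose c : cochain_pair k G F :=
  ([ffun a => dehomogF w a - dehomogF (homog mp v) a],
   [ffun a => dehomogG w a - dehomogG (homog mp v) a]).
have cD : c \in datum_pred mp.
  apply/datum_predP; split; first by split=> *; rewrite ffunE; [apply: nF | apply: nG].
  have [c1 c2 c3] := is_cocycleB wST (dehomog_cocycle iF iG).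
  by split=> *; rewrite !ffunE; [apply: c1 | apply: c2 | apply: c3].
pose p : datum k mp := Datum cD; exists p.
pose w' z := w z - primitive mp (val p).1 (val p).2 z.
have w'_inv : inv_dF mp w' /\ inv_dG mp w'.
  exact: inv_diffB w_inv (primitive_inv (datum_cocycle p)).
have w'v : d_closed (fun z => w' z - homog mp v z).
  apply/d_closedB; split=> *.
    rewrite dFB (dF_primitive (datum_cocycle p)).
    rewrite (dF_homogF _ _ _ _ _ wF) (dF_homogF _ _ _ _ _ iF).
    by rewrite /homogF ffunE; zmod.
  rewrite dGB (dG_primitive (datum_cocycle p)).
  rewrite (dG_homogG _ _ _ _ _ wG) (dG_homogG _ _ _ _ _ iG).
  by rewrite /homogG ffunE; zmod.
have -> : r - datum_map p = restr w'_inv.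
  apply: linear_ext => x; rewrite -[LHS]/(r x - datum_map p x) rE.
  rewrite -[LHS]/(eval_at _ (val x) - eval_at _ (val x)) -eval_atN -eval_atD.
  by [].
by apply/extends_restrP; exists (homog mp v); split; first exact: homog_inv.
Qed.

Local Notation Lam := (Lambda (bowtie_gset mp)).
Local Notation H3 := (rel_cohomology (bowtie_gset mp) 3 A).

Definition ext2_class (r : {linear syzygy Lam 2 -> A}) : H3 :=
  (\pi_(Quotient.quot (@coboundary_pred _ _ (std_res Lam) A 2)) (cocycle_of r))%qT.

Lemma ext2_class_surj c : exists r, c = ext2_class r.
Proof.
have [r rE] := cocycle_of_surj (generic_quotient.repr (c : Quotient.quot _)).
by exists r; rewrite /ext2_class -rE reprK.
Qed.

Lemma ext2_classB r r' : ext2_class (r - r') = ext2_class r - ext2_class r'.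
Proof.
rewrite /ext2_class -raddfB; congr (\pi_ _ _)%qT.
by apply/val_inj/linear_ext.
Qed.

Lemma ext2_class_eq0 r :
  ext2_class r = 0 <-> @extends _ _ A (std_two_step Lam) r.
Proof.
rewrite -cocycle_of_coboundary.
have e : (cocycle_of r \in @coboundary_pred _ _ (std_res Lam) A 2) =
    (ext2_class r == 0).
  by rewrite -[cocycle_of r in LHS]subr0 Quotient.idealrBE raddf0.
split=> [/eqP|r0]; first by rewrite -e => /asboolP.
by apply/eqP; rewrite -e; apply/asboolP.
Qed.
End Assembly.

Theorem theorem3p9 (k : fieldType) (G F : finGroupType)
    (mp : matched_pair G F) :
  exists f : {additive Opext k mp ->
      rel_cohomology (bowtie_gset mp) 3 (trivial_module (bowtie mp) (kstar k))},
    bijective f.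
Proof.
have [a [a_ext a_surj]] := two_step_comparison
  (trivial_module (bowtie mp) (kstar k)) (std_two_step _) (bowtie_two_step mp).
(* [a] compares the standard resolution with the one on F^2 x G^2. *)
pose h (p : datum k mp) := ext2_class (datum_map p \o a).
have hB p q : h (p - q) = h p - h q.
  rewrite -ext2_classB; congr (ext2_class _); apply: linear_ext => u.
  exact: (congr1 (fun r : {linear _ -> _} => r (a u)) (datum_mapB p q)).
have h_eq p q : h p = h q <-> ext_class p = ext_class q.
  rewrite ext_classP ext_equivP -datum_map_extendsP -a_ext -ext2_class_eq0 -/(h _) hB.
  by split=> [->|/eqP]; rewrite ?subrr // subr_eq0 => /eqP.
have h_surj c : exists p, h p = c.
  have [r ->] := ext2_class_surj c; have [r' rr'] := a_surj r.
  have [p /a_ext r'p] := datum_map_surj r'; exists p.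
  apply/eqP; rewrite eq_sym -subr_eq0 -ext2_classB; apply/eqP/ext2_class_eq0.
  have [u uE] := rr'; have [v vE] := r'p.
  exists (u + v) => z; rewrite -[RHS]/(u _ + v _) -uE -vE.
  by rewrite -[LHS]/(_ - _) -[RHS]/(_ - _ + (_ - _)) addrA subrK.
pose f (c : Opext k mp) := h (generic_quotient.repr c).
have fE p : f (ext_class p) = h p by apply/h_eq; rewrite /ext_class reprK.
have f_add : zmod_morphism f.
  move=> b c; have [p ->] := ext_class_surj b; have [q ->] := ext_class_surj c.
  have -> : ext_class p - ext_class q = ext_class (p - q).
    by rewrite ext_classD ext_classN.
  by rewrite !fE hB.
pose f' : {additive Opext k mp -> _} :=
  HB.pack f (GRing.isZmodMorphism.Build _ _ f f_add).
exists f'.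
have [g gE] := boolp.choice h_surj.
exists (fun c => ext_class (g c)) => [b|c] /=; last by rewrite fE gE.
have [p ->] := ext_class_surj b; apply/h_eq; rewrite gE.
exact: fE.
Qed.
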